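(* Let $\{P_\gamma\}_{\gamma\in I}$ be a net in $\mathcal M$ and $P\in\mathcal M$. Then $P_\gamma$ converges to $P$ vaguely if and only if $\lim_{\gamma\in I}\int_{\mathbb R}f\,dP_\gamma=\int_{\mathbb R}f\,dP$ in operator norm for every $f\in C_c(\mathbb R)$.
   Context: $\mathcal H=L^2([0,1])$. For a bounded measurable symmetric $W:[0,1]^2\to[0,1]$ (a graphon; the set of these is $\mathcal W_0$), $K_W f(x)=\int_0^1W(x,y)f(y)\,dy$ is compact self-adjoint on $\mathcal H$. For $\lambda\in\mathbb R$, $P_W(\{\lambda\})$ is the orthogonal projection onto $\ker(K_W-\lambda I)$, and for Borel $A\subseteq\mathbb R$, $P_W(A)=\sum_{\lambda\in\sigma(K_W)\cap A}P_W(\{\lambda\})$ (strong operator topology sum). $\mathcal M=\{P_W:W\in\mathcal W_0\}$. For a bounded Borel $f$ and $P=P_W$, $\int f\,dP=\sum_{\lambda\in\sigma(K_W)}f(\lambda)P_W(\{\lambda\})$ (equivalently, the operator-norm limit of the integrals of simple functions converging uniformly to $f$). A net $P_\gamma$ in $\mathcal M$ converges vaguely to $P\in\mathcal M$ if there is a dense set $D\subseteq\mathbb R$ such that $\lim_\gamma P_\gamma((a,b])=P((a,b])$ in operator norm for all $a,b\in D$. *)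

(* Defs.v *)
(* H = L^2([0,1]) is modelled concretely: vectors are
   functions R -> R that are measurable and square integrable on [0,1]; two
   vectors are identified when the L^2 seminorm of their difference is 0.
   Operators are maps (R -> R) -> (R -> R); only their action on L^2 vectors
   matters for all notions below. *)
From HB Require Import structures.
From mathcomp Require Import all_boot all_order all_algebra.
From mathcomp Require Import all_classical all_reals all_analysis.
From Stdlib Require Import ClassicalEpsilon.
Set Implicit Arguments. Unset Strict Implicit. Unset Printing Implicit Defensive.
Import Order.TTheory GRing.Theory Num.Theory.
Import numFieldNormedType.Exports.
Local Open Scope classical_set_scope.
Local Open Scope ring_scope.

Section L2.
Variable R : realType.

Definition leb := (@lebesgue_measure R).
Definition I01 : set R := `[0%R, 1%R].

Definition L2 (f : R -> R) : Prop :=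
  measurable_fun I01 f /\ (\int[leb]_(x in I01) ((f x) ^+ 2)%:E < +oo)%E.

Definition ip (f g : R -> R) : R := Rintegral leb I01 (fun x => f x * g x).
Definition nrm (f : R -> R) : R := Num.sqrt (ip f f).

Definition op := (R -> R) -> (R -> R).

Definition opnorm (T : op) : \bar R :=
  ereal_sup [set (nrm (T f))%:E | f in [set f | L2 f /\ nrm f <= 1]].

Definition opsub (T U : op) : op := fun f x => T f x - U f x.

Definition graphon (W : R -> R -> R) : Prop :=
  measurable_fun (I01 `*` I01) (fun p : R * R => W p.1 p.2) /\
  (forall x y, I01 x -> I01 y -> 0 <= W x y <= 1) /\
  (forall x y, I01 x -> I01 y -> W x y = W y x).

Definition K (W : R -> R -> R) : op :=
  fun f x => Rintegral leb I01 (fun y => W x y * f y).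

Definition Kshift (W : R -> R -> R) (l : R) : op :=
  fun f x => K W f x - l * f x.

(* invertibility of an operator on H (bijective on equivalence classes) *)
Definition invertible (T : op) : Prop :=
  (forall f, L2 f -> nrm (T f) = 0 -> nrm f = 0) /\
  (forall g, L2 g -> exists f, L2 f /\ nrm (fun x => T f x - g x) = 0).

Definition spec (W : R -> R -> R) : set R :=
  [set l | ~ invertible (Kshift W l)].

Definition eigsp (W : R -> R -> R) (l : R) : set (R -> R) :=
  [set f | L2 f /\ nrm (Kshift W l f) = 0].

Definition is_proj (V : set (R -> R)) (Q : op) : Prop :=
  forall f, L2 f -> V (Q f) /\
    (forall g, V g -> ip (fun x => f x - Q f x) g = 0).

Definition opchoose (P : op -> Prop) : op :=
  epsilon (inhabits (fun f : R -> R => f)) P.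

Definition Pt (W : R -> R -> R) (l : R) : op := opchoose (is_proj (eigsp W l)).

(* Q = sum_{l in S} c(l) T(l) in the strong operator topology
   (unordered sum: limit along the net of finite subsets of S) *)
Definition is_sot_sum (S : set R) (c : R -> R) (T : R -> op) (Q : op) : Prop :=
  forall f, L2 f -> L2 (Q f) /\
    forall eps : R, 0 < eps -> exists s0 : seq R, uniq s0 /\ {subset s0 <= S} /\
      forall s : seq R, uniq s -> {subset s <= S} -> {subset s0 <= s} ->
        nrm (fun x => Q f x - \sum_(l <- s) c l * T l f x) < eps.

Definition PW (W : R -> R -> R) (A : set R) : op :=
  opchoose (is_sot_sum (spec W `&` A) (fun=> 1) (Pt W)).

Definition intPW (W : R -> R -> R) (f : R -> R) : op :=
  opchoose (is_sot_sum (spec W) f (Pt W)).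

Definition directed_set (I : Type) (le : I -> I -> Prop) : Prop :=
  inhabited I /\ (forall i, le i i) /\
  (forall i j k, le i j -> le j k -> le i k) /\
  (forall i j, exists k, le i k /\ le j k).

Definition opnorm_lim (I : Type) (le : I -> I -> Prop) (A : I -> op) (B : op) :=
  forall eps : R, 0 < eps -> exists i0, forall i, le i0 i ->
    (opnorm (opsub (A i) B) < eps%:E)%E.

Definition vague_conv (I : Type) (le : I -> I -> Prop)
    (Wn : I -> R -> R -> R) (W0 : R -> R -> R) : Prop :=
  exists D : set R, dense D /\
    forall a b, D a -> D b ->
      opnorm_lim le (fun i => PW (Wn i) `]a, b]) (PW W0 `]a, b]).

Definition Cc (f : R -> R) : Prop :=
  continuous f /\ compact (closure [set x | f x != 0]).

End L2.

(* Main.v *)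
Require Import Defs.
From HB Require Import structures.
From mathcomp Require Import all_boot all_order all_algebra.
From mathcomp Require Import all_classical all_reals all_analysis.
From mathcomp Require Import measurable_realfun ring lra.
From Stdlib Require Import ClassicalEpsilon.
Set Implicit Arguments. Unset Strict Implicit. Unset Printing Implicit Defensive.
Import Order.TTheory GRing.Theory Num.Theory.
Import numFieldNormedType.Exports.
Local Open Scope classical_set_scope.
Local Open Scope ring_scope.

(** The eigenspaces of K_W are closed and pairwise orthogonal, so a spectral sum
    of bounded coefficients c(l) converges strongly and has operator norm at
    most the supremum of |c(l)| over the eigenvalues l of K_W; hence P_W(A)
    and the integral of f are compared by comparing the functions 1_A and f on
    the eigenvalues.  If P_i tends vaguely to P, a function in C_c is a
    uniform limit of step functions with jumps in the dense set D.
    Conversely, let D be the set of points with a neighbourhood free of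
    eigenvalues of W_0.  It is dense because the squares of the
    eigenvalues have sum at most 1.  Testing with tents at a, b in D shows that
    the eigenvalues of W_i eventually keep away from a and b, and then
    1_]a, b] agrees on all spectra with a continuous trapezoid. *)

(** Different graphons have unrelated eigenvectors, so comparing coefficient functions works only
    for one fixed graphon. The passage from [Wn i] to [W0] is therefore always taken from the
    hypothesis, for a step operator or for one function in C_c, and a comparison whose error is
    uniform in the graphon is attached on either side. A point of the spectrum that is not an
    eigenvalue has a null eigenspace and contributes nothing, so bounds on coefficients are asked at
    eigenvalues only. Vectors are functions up to null sets and the operators are picked by
    [epsilon]. Equality of vectors thus means a difference of seminorm 0, and the Hilbert space
    theory is developed for semi-inner products. Membership in D requires a whole free
    neighbourhood, because eigenvalues may accumulate at 0 without 0 being one, and a tent needs a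
    positive distance in order to vanish at all of them. *)

(** * Two elementary inequalities *)

Lemma le_geometric_half (R : realType) (C x : R) :
  (forall n, x <= C * 2^-1 ^+ n) -> x <= 0.
Proof.
move=> h; rewrite leNgt; apply/negP => x0.
have C0 : 0 < C by have := h 0%N; rewrite expr0 mulr1; exact: lt_le_trans.
have [n Cn] : exists n, C / x < n%:R.
  exists (Num.truncn (C / x)).+1; exact: truncnS_gt.
have n2 : n%:R <= 2 ^+ n :> R.
  by rewrite -natrX ler_nat; apply: ltnW; exact: ltn_expl.
have := h n; rewrite exprVn ler_pdivlMr ?exprn_gt0// => h'.
have : C / x < 2 ^+ n by exact: lt_le_trans n2.
rewrite ltr_pdivrMr// ltNge => /negP; apply.
by rewrite mulrC.
Qed.

(** Evaluate at the minimum t = p / q. This serves Cauchy-Schwarz and, with [e] the defect of a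
    minimizing sequence, approximate orthogonality. A seminorm can vanish on nonzero vectors, hence
    the case q = 0. *)
Lemma discriminant_le (R : realFieldType) (e p q : R) : 0 <= q ->
  (forall t, 0 <= e - t * p *+ 2 + t ^+ 2 * q) -> p ^+ 2 <= e * q.
Proof.
rewrite le_eqVlt => /orP[/eqP <-|q0] key.
  rewrite mulr0; have [->|p0] := eqVneq p 0; first by rewrite expr0n.
  (* The form is now affine in [t], and this [t] gives it the value -1. *)
  have := key ((e + 1) / (p *+ 2)).
  rewrite mulr0 addr0 -mulrnAr divfK ?mulrn_eq0//.
  by rewrite opprD addrA subrr add0r oppr_ge0 leNgt ltr01.
have := key (p / q).
have -> : e - p / q * p *+ 2 + (p / q) ^+ 2 * q = (e * q - p ^+ 2) / q.
  by field; rewrite gt_eqF.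
by rewrite pmulr_lge0 ?invr_gt0// subr_ge0.
Qed.

(** * Semi-inner products *)

(** [ip] is total but bilinear only on [H]: integrals of products need not add for functions that
    are not square integrable. Definiteness is absent because L^2 functions are not quotiented by
    null sets. *)
Record semi_inner (R : realType) (V : lmodType R) (H : V -> Prop)
    (ip : V -> V -> R) : Prop := SemiInner {
  si0 : H 0;
  siD : forall f g, H f -> H g -> H (f + g);
  siZ : forall a f, H f -> H (a *: f);
  si_sym : forall f g, ip f g = ip g f;
  si_addl : forall f g h, H f -> H g -> H h -> ip (f + g) h = ip f h + ip g h;
  si_scalel : forall a f g, H f -> H g -> ip (a *: f) g = a * ip f g;
  si_ge0 : forall f, 0 <= ip f f }.

Definition seminorm (R : realType) (V : lmodType R) (ip : V -> V -> R) f :=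
  Num.sqrt (ip f f).

Section SemiInner.
Variables (R : realType) (V : lmodType R) (H : V -> Prop) (ip : V -> V -> R).
Hypothesis hS : semi_inner H ip.
Local Notation nm := (seminorm ip).

Lemma siN f : H f -> H (- f).
Proof. by move=> Hf; rewrite -scaleN1r; exact: siZ hS _ _ Hf. Qed.

Lemma siB f g : H f -> H g -> H (f - g).
Proof. by move=> Hf Hg; apply: (siD hS) => //; exact: siN. Qed.

Lemma si_sum (I : Type) (s : seq I) (P : pred I) (F : I -> V) :
  (forall i, P i -> H (F i)) -> H (\sum_(i <- s | P i) F i).
Proof. by move=> HF; apply: (big_ind H); [exact: si0 hS|exact: siD hS|]. Qed.

Lemma si_addr f g h : H f -> H g -> H h -> ip h (f + g) = ip h f + ip h g.
Proof. by move=> Hf Hg Hh; rewrite !(si_sym hS h) (si_addl hS). Qed.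

Lemma si_scaler a f g : H f -> H g -> ip g (a *: f) = a * ip g f.
Proof. by move=> Hf Hg; rewrite !(si_sym hS g) (si_scalel hS). Qed.

Lemma si_oppl f g : H f -> H g -> ip (- f) g = - ip f g.
Proof. by move=> Hf Hg; rewrite -scaleN1r (si_scalel hS) // mulN1r. Qed.

Lemma si_oppr f g : H f -> H g -> ip g (- f) = - ip g f.
Proof. by move=> Hf Hg; rewrite !(si_sym hS g) si_oppl. Qed.

Lemma si_0l g : H g -> ip 0 g = 0.
Proof.
by move=> Hg; rewrite -(scale0r g) (si_scalel hS)// mul0r.
Qed.

Lemma si_suml (I : Type) (s : seq I) (F : I -> V) g :
  (forall i, H (F i)) -> H g ->
  ip (\sum_(i <- s) F i) g = \sum_(i <- s) ip (F i) g.
Proof.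
move=> HF Hg; elim: s => [|i s IHs]; first by rewrite !big_nil si_0l.
by rewrite !big_cons (si_addl hS) ?IHs//; exact: si_sum.
Qed.

Lemma nm_ge0 f : 0 <= nm f. Proof. exact: sqrtr_ge0. Qed.

Lemma nm_sqr f : nm f ^+ 2 = ip f f.
Proof. by rewrite sqr_sqrtr ?(si_ge0 hS). Qed.

Lemma ip_sqrD f g : H f -> H g ->
  ip (f + g) (f + g) = ip f f + ip f g *+ 2 + ip g g.
Proof.
move=> Hf Hg; have HD := siD hS Hf Hg.
by rewrite (si_addl hS)// !si_addr// (si_sym hS g f); ring.
Qed.

Lemma ip_sqrB f g : H f -> H g ->
  ip (f - g) (f - g) = ip f f - ip f g *+ 2 + ip g g.
Proof.
move=> Hf Hg; have HN := siN Hg.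
by rewrite ip_sqrD// si_oppr// si_oppl// si_oppr//; ring.
Qed.

Lemma cauchy_schwarz f g : H f -> H g -> `|ip f g| <= nm f * nm g.
Proof.
move=> Hf Hg.
have key t : 0 <= ip f f - t * ip f g *+ 2 + t ^+ 2 * ip g g.
  have Ht := siZ hS t Hg; have := si_ge0 hS (f - t *: g).
  rewrite ip_sqrB// si_scaler// (si_scalel hS)// si_scaler//.
  by congr (0 <= _); ring.
rewrite -ler_sqr ?nnegrE ?mulr_ge0 ?nm_ge0 ?normr_ge0//.
rewrite exprMn !nm_sqr real_normK ?num_real//.
apply: discriminant_le key; exact: (si_ge0 hS).
Qed.

Lemma nmD f g : H f -> H g -> nm (f + g) <= nm f + nm g.
Proof.
move=> Hf Hg; rewrite -ler_sqr ?nnegrE ?addr_ge0 ?nm_ge0//.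
rewrite nm_sqr ip_sqrD// sqrrD !nm_sqr lerD2r lerD2l ler_wMn2r//.
exact: le_trans (ler_norm _) (cauchy_schwarz Hf Hg).
Qed.

Lemma nmZ a f : H f -> nm (a *: f) = `|a| * nm f.
Proof.
move=> Hf; rewrite /seminorm (si_scalel hS) ?si_scaler//; last exact: siZ hS _ _ Hf.
by rewrite mulrA -expr2 sqrtrM ?sqr_ge0// sqrtr_sqr.
Qed.

Lemma nmN f : H f -> nm (- f) = nm f.
Proof. by move=> Hf; rewrite -scaleN1r nmZ// normrN1 mul1r. Qed.

Lemma nm0 : nm 0 = 0.
Proof. by rewrite /seminorm si_0l ?sqrtr0//; exact: si0 hS. Qed.

Lemma nmBC f g : H f -> H g -> nm (f - g) = nm (g - f).
Proof. by move=> Hf Hg; rewrite -nmN ?opprB//; exact: siB. Qed.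

Lemma nm_tri f g h : H f -> H g -> H h -> nm (f - h) <= nm (f - g) + nm (g - h).
Proof.
move=> Hf Hg Hh; rewrite (_ : f - h = (f - g) + (g - h)).
  by apply: nmD; exact: siB.
by rewrite addrA subrK.
Qed.

Lemma nm_tri0 f g : H f -> H g -> nm f <= nm (f - g) + nm g.
Proof.
move=> Hf Hg; have := nmD (siB Hf Hg) Hg; by rewrite subrK.
Qed.

Lemma nm_eq0_ip f g : H f -> H g -> nm f = 0 -> ip f g = 0.
Proof.
move=> Hf Hg f0; apply/eqP; rewrite -normr_le0.
by apply: le_trans (cauchy_schwarz Hf Hg) _; rewrite f0 mul0r.
Qed.

Lemma parallelogram f g : H f -> H g ->
  nm (f - g) ^+ 2 + nm (f + g) ^+ 2 = (nm f ^+ 2 + nm g ^+ 2) *+ 2.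
Proof. by move=> Hf Hg; rewrite !nm_sqr ip_sqrB// ip_sqrD//; ring. Qed.

Section Orthogonal.
Variables (I : eqType) (v : I -> V).
Hypotheses (Hv : forall i, H (v i)).
Hypothesis vorth : forall i j, i != j -> ip (v i) (v j) = 0.

Lemma pythagoras (s : seq I) (c : I -> R) : uniq s ->
  nm (\sum_(i <- s) c i *: v i) ^+ 2 = \sum_(i <- s) c i ^+ 2 * nm (v i) ^+ 2.
Proof.
have Hcv i : H (c i *: v i) by exact: siZ hS _ _ _.
elim: s => [|i s IHs]/=; first by rewrite !big_nil nm0 expr0n.
move=> /andP[si us]; rewrite !big_cons nm_sqr ip_sqrD//; last exact: si_sum.
rewrite -!nm_sqr IHs// nmZ// exprMn real_normK ?num_real//.
rewrite (si_sym hS) si_suml// big1_seq ?mul0rn ?addr0// => j /andP[_ js].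
rewrite (si_scalel hS)// si_scaler// vorth ?mulr0//.
by apply: contraNneq si => <-.
Qed.

(** The hypothesis on [ip f (v i)] says that [v i] is the projection of [f] onto the i-th of several
    orthogonal subspaces, so no normalization occurs. Expand the square of [f] minus the sum. *)
Lemma bessel f (s : seq I) : H f -> uniq s ->
  (forall i, i \in s -> ip f (v i) = nm (v i) ^+ 2) ->
  \sum_(i <- s) nm (v i) ^+ 2 <= nm f ^+ 2.
Proof.
move=> Hf us fv; have Hsum : H (\sum_(i <- s) v i) by exact: si_sum.
have := si_ge0 hS (f - \sum_(i <- s) v i); rewrite ip_sqrB//.
rewrite -!nm_sqr (si_sym hS) si_suml//.
have -> : \sum_(i <- s) v i = \sum_(i <- s) (1 : R) *: v i.
  by apply: eq_bigr => i _; rewrite scale1r.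
rewrite (pythagoras (fun=> 1))//.
have -> : \sum_(i <- s) ip (v i) f = \sum_(i <- s) nm (v i) ^+ 2.
  by rewrite big_seq [RHS]big_seq; apply: eq_bigr => i si; rewrite (si_sym hS) fv.
have -> : \sum_(i <- s) 1 ^+ 2 * nm (v i) ^+ 2 = \sum_(i <- s) nm (v i) ^+ 2.
  by apply: eq_bigr => i _; rewrite expr1n mul1r.
by move=> h; lra.
Qed.

(** The bound on [c] is asked only where [v i] is not null; for projections onto eigenspaces these
    indices are eigenvalues. *)
Lemma nm_sum_le (M : R) (s : seq I) (c : I -> R) : uniq s ->
  (forall i, i \in s -> nm (v i) != 0 -> `|c i| <= M) ->
  nm (\sum_(i <- s) c i *: v i) ^+ 2 <= M ^+ 2 * \sum_(i <- s) nm (v i) ^+ 2.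
Proof.
move=> us cM; rewrite pythagoras// mulr_sumr big_seq [leRHS]big_seq.
apply: ler_sum => i si; have [->|vi] := eqVneq (nm (v i)) 0.
  by rewrite expr0n !mulr0.
rewrite ler_wpM2r ?sqr_ge0// -(real_normK (num_real (c i))).
rewrite ler_sqr ?nnegrE ?cM//; exact: le_trans (cM _ si vi).
Qed.

End Orthogonal.

End SemiInner.

(** * Projections and unordered orthogonal sums in complete spaces *)

Section Complete.
Variables (R : realType) (V : lmodType R) (H : V -> Prop) (ip : V -> V -> R).
Hypothesis hS : semi_inner H ip.
Local Notation nm := (seminorm ip).

(** Completeness for sequences with the explicit rate 2^-n, so that [V] carries no topology; the
    constructions below produce sequences with this rate directly. *)
Definition fast_complete := forall u : nat -> V, (forall n, H (u n)) ->
  (forall n m, (n <= m)%N -> nm (u m - u n) <= 2^-1 ^+ n) ->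
  exists f, H f /\ forall n, nm (u n - f) <= 2^-1 ^+ n.

Hypothesis hC : fast_complete.

(** The point of [E] nearest to [f], obtained as the limit of a minimizing sequence that the
    parallelogram law makes Cauchy. *)
Lemma projection_exists (E : V -> Prop) : (forall g, E g -> H g) -> E 0 ->
  (forall f g, E f -> E g -> E (f + g)) -> (forall a f, E f -> E (a *: f)) ->
  (forall u f, (forall n, E (u n)) -> H f ->
    (forall n, nm (u n - f) <= 2^-1 ^+ n) -> E f) ->
  forall f, H f -> exists g, E g /\ forall h, E h -> ip (f - g) h = 0.
Proof.
move=> EH E0 ED EZ Ecl f Hf.
pose A : set R := [set nm (f - g) ^+ 2 | g in [set g | E g]].
have A0 : A !=set0 by exists (nm (f - 0) ^+ 2), 0.
have Alb : lbound A 0 by move=> _ [g _ <-]; exact: sqr_ge0.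
have hA : has_inf A by split=> //; exists 0.
pose d := inf A.
have dle g : E g -> d <= nm (f - g) ^+ 2.
  by move=> Eg; apply: ge_inf; [exists 0|exists g].
(* For n <= m the parallelogram law bounds the squared distance of [g n] and [g m] by 2 (e n + e m)
   <= 4 e n, which is the square of 2^-n. *)
pose e n : R := 4^-1 * (2^-1 ^+ n) ^+ 2.
have e0 n : 0 < e n by rewrite mulr_gt0// exprn_gt0// exprn_gt0.
have /choice[g hg] n : exists g, E g /\ nm (f - g) ^+ 2 < d + e n.
  by have [_ [g Eg <-] ?] := inf_adherent (e0 n) hA; exists g.
have Hg n : H (g n) by apply: EH; have [] := hg n.
(* [g n] is minimal up to [e n]; moving it by [t *: h] yields a nonnegative quadratic in [t]. *)
have approx n h : E h -> ip (f - g n) h ^+ 2 <= e n * ip h h.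
  move=> Eh; have [Egn gn] := hg n; have Hh := EH _ Eh.
  have HB : H (f - g n) by exact: (siB hS).
  apply: discriminant_le => [|t]; first exact: si_ge0 hS _.
  have Ht : H (t *: h) := siZ hS t Hh.
  have := dle _ (ED _ _ Egn (EZ t _ Eh)).
  rewrite opprD addrA (nm_sqr hS) (ip_sqrB hS)// (si_scaler hS)// (si_scalel hS)//.
  rewrite (si_scaler hS)// -(nm_sqr hS (f - g n)).
  rewrite [t * (t * _)]mulrA -expr2; lra.
have [q [Hq qg]] : exists q, H q /\ forall n, nm (g n - q) <= 2^-1 ^+ n.
  apply: hC => // n m nm_; have [Em gm] := hg m; have [En gn] := hg n.
  rewrite -ler_sqr ?nnegrE ?nm_ge0 ?exprn_ge0//.
  have Hfm : H (f - g m) by exact: (siB hS).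
  have Hfn : H (f - g n) by exact: (siB hS).
  have := parallelogram hS Hfn Hfm.
  have -> : f - g n - (f - g m) = g m - g n by rewrite opprB addrC addrA subrK.
  have -> : f - g n + (f - g m) = 2 *: (f - 2^-1 *: (g n + g m)).
    rewrite scalerBr scalerA divff// scale1r (scalerDl f 1 1) scale1r opprD.
    by rewrite addrACA.
  have Emid : E (2^-1 *: (g n + g m)) by apply: EZ; exact: ED.
  have Hmid := EH _ Emid.
  rewrite (nmZ hS) ?exprMn; last exact: (siB hS).
  rewrite real_normK ?num_real// => pl.
  have := dle _ Emid.
  have : e m <= e n.
    rewrite ler_pM2l// ler_sqr ?nnegrE ?exprn_ge0//.
    by rewrite ler_wiXn2l// invf_le1// ler1n.
  rewrite /e in gn gm *; lra.
exists q; split; first by apply: (Ecl g) => // n; have [] := hg n.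
move=> h Eh; have Hh := EH _ Eh; apply/eqP; rewrite -normr_le0.
apply: (@le_geometric_half _ (nm h *+ 2)) => n.
have -> : f - q = (f - g n) + (g n - q) by rewrite addrA subrK.
rewrite (si_addl hS)//; [|exact: (siB hS)..].
apply: le_trans (ler_normD _ _) _.
have h2 : `|ip (g n - q) h| <= 2^-1 ^+ n * nm h.
  apply: le_trans (cauchy_schwarz hS (siB hS _ _) Hh) _ => //.
  by rewrite ler_wpM2r ?nm_ge0.
have h1 : `|ip (f - g n) h| <= 2^-1 ^+ n * nm h.
  rewrite -ler_sqr ?nnegrE ?mulr_ge0 ?nm_ge0 ?exprn_ge0//.
  rewrite real_normK ?num_real// exprMn (nm_sqr hS).
  apply: le_trans (approx n h Eh) _; rewrite ler_wpM2r ?(si_ge0 hS)//.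
  by rewrite /e ler_piMl ?sqr_ge0// invf_le1// ler1n.
by rewrite mulrnAl mulr2n mulrC lerD.
Qed.

Section Sums.
Variables (I : eqType) (v : I -> V).
Hypotheses (Hv : forall i, H (v i)).
Hypothesis vorth : forall i j, i != j -> ip (v i) (v j) = 0.
Variables (f : V) (S : set I) (c : I -> R) (M : R).
Hypothesis Hf : H f.
Hypothesis fv : forall i, ip f (v i) = nm (v i) ^+ 2.
Hypothesis cM : forall i, nm (v i) != 0 -> `|c i| <= M.

Lemma sum_subseq (s t : seq I) (W : zmodType) (F : I -> W) :
  uniq s -> uniq t -> {subset s <= t} ->
  \sum_(i <- t) F i =
    \sum_(i <- s) F i + \sum_(i <- [seq i <- t | i \notin s]) F i.
Proof.
move=> us ut st; rewrite -big_cat; apply: perm_big; apply: uniq_perm => //.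
  rewrite cat_uniq us filter_uniq// andbT -all_predC.
  by apply/allP => i; rewrite mem_filter => /andP[].
move=> i; rewrite mem_cat mem_filter; case: (boolP (i \in s)) => //= /st.
by [].
Qed.

(** By Bessel the finite sums of [nm (v i) ^+ 2] have a supremum, and a finite set that nearly
    attains it leaves little mass to any finite set disjoint from it. This handles an arbitrary
    index set [S] without enumerating it. *)
Lemma orthogonal_sum_exists : exists q, H q /\
  forall eps : R, 0 < eps -> exists s0 : seq I, [/\ uniq s0, {subset s0 <= S} &
    forall s : seq I, uniq s -> {subset s <= S} -> {subset s0 <= s} ->
      nm (q - \sum_(i <- s) c i *: v i) < eps].
Proof.
pose a (s : seq I) := \sum_(i <- s) nm (v i) ^+ 2.
pose A : set R := [set a s | s in [set s | uniq s /\ {subset s <= S}]].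
have Aub : ubound A (nm f ^+ 2).
  by move=> _ [s [us _] <-]; apply: (bessel hS) => // i _; exact: fv.
have hA : has_sup A.
  by split; [exists (a [::]), [::]; split|exists (nm f ^+ 2)].
have ale s : uniq s -> {subset s <= S} -> a s <= sup A.
  by move=> us sS; apply: ub_le_sup; [exists (nm f ^+ 2)|exists s].
(* Mass at most [e n], weighted by coefficients bounded by [M], has norm at most 2^-n; the added 1
   keeps the denominator positive when M = 0. *)
pose e n : R := (2^-1 ^+ n) ^+ 2 / (M ^+ 2 + 1).
have M1 : 0 < M ^+ 2 + 1 by rewrite ltr_pwDr// sqr_ge0.
have e0 n : 0 < e n by rewrite divr_gt0// exprn_gt0// exprn_gt0.
have /choice[s hs] n : exists s, [/\ uniq s, {subset s <= S} & sup A - e n < a s].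
  by have [_ [s [us sS] <-] ?] := sup_adherent (e0 n) hA; exists s.
(* Unions of the first sets make the family increasing, as the Cauchy estimate requires. *)
pose t n := undup (flatten [seq s k | k <- iota 0 n.+1]).
have ut n : uniq (t n) by exact: undup_uniq.
have memt n i : (i \in t n) = has (fun k => i \in s k) (iota 0 n.+1).
  rewrite mem_undup; apply/flatten_mapP/hasP => -[k k1 k2]; by exists k.
have tS n : {subset t n <= S}.
  by move=> i; rewrite memt => /hasP[k _]; have [_ sS _] := hs k; exact: sS.
have tt n m : (n <= m)%N -> {subset t n <= t m}.
  move=> nm_ i; rewrite !memt => /hasP[k]; rewrite mem_iota add0n ltnS => kn ik.
  apply/hasP; exists k => //; rewrite mem_iota add0n ltnS.
  exact: leq_trans nm_.
have st n : {subset s n <= t n}.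
  move=> i si; rewrite memt; apply/hasP; exists n => //.
  by rewrite mem_iota add0n ltnSn.
pose u n := \sum_(i <- t n) c i *: v i.
have Hcv i : H (c i *: v i) by exact: siZ hS _ _ _.
have Hsum (r : seq I) : H (\sum_(i <- r) c i *: v i) by exact: (si_sum hS).
have key n r : uniq r -> {subset r <= S} -> {subset t n <= r} ->
    nm (\sum_(i <- r) c i *: v i - u n) <= 2^-1 ^+ n.
  move=> ur rS tr; rewrite -ler_sqr ?nnegrE ?nm_ge0 ?exprn_ge0//.
  rewrite (sum_subseq _ (ut n) ur tr) addrC addKr.
  apply: le_trans (nm_sum_le hS Hv vorth (M := M) _ _) _.
  - by rewrite filter_uniq.
  - by move=> i _; exact: cM.
  have := ale _ ur rS; have [us _ h1] := hs n; move: h1.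
  have snr : {subset s n <= r} by move=> i /st /tr.
  rewrite /a (sum_subseq (fun i => nm (v i) ^+ 2) (ut n) ur tr).
  rewrite (sum_subseq (fun i => nm (v i) ^+ 2) us (ut n) (st n)).
  move=> h1; set x := (X in X + _ + _); set y := (X in _ + X + _).
  set z := (X in _ + X <= _).
  have y0 : 0 <= y by apply: sumr_ge0 => i _; exact: sqr_ge0.
  move=> h2; have ze : z <= e n by rewrite -/x in h1; lra.
  have z0 : 0 <= z by apply: sumr_ge0 => i _; exact: sqr_ge0.
  apply: (@le_trans _ _ ((M ^+ 2 + 1) * z)); first by rewrite mulrDl mul1r lerDl.
  by move: ze; rewrite /e ler_pdivlMr// mulrC.
have [q [Hq uq]] : exists q, H q /\ forall n, nm (u n - q) <= 2^-1 ^+ n.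
  apply: hC => [n|n m nm_]; first exact: Hsum.
  by apply: key => //; exact: tt.
exists q; split=> // eps eps0.
(* One 2^-n for the distance from [q] to [u n], one for the distance from [u n] to the larger finite
   sum. *)
have [n n_eps] : exists n, 2 * 2^-1 ^+ n < eps.
  apply/not_existsP => h; have : eps <= 0.
    by apply: (@le_geometric_half _ 2) => n; rewrite leNgt; apply/negP; exact: h.
  by rewrite leNgt eps0.
exists (t n); split=> // r ur rS tr; apply: le_lt_trans n_eps.
have Hu : H (u n) by exact: Hsum.
apply: le_trans (nm_tri hS Hq Hu _) _ => //.
rewrite mulr2n mulrDl mul1r lerD//.
  by rewrite (nmBC hS).
by rewrite (nmBC hS)//; exact: key.
Qed.

End Sums.
End Complete.

(** * The space of square integrable functions on the unit interval *)

Section L2Space.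
Variable R : realType.
Local Notation mu := (@lebesgue_measure R).
Local Notation I := (@I01 R : set (measurableTypeR R)).
Implicit Types f g h : R -> R.

Lemma measurable_I01 : measurable I.
Proof. exact: measurable_itv. Qed.

Lemma leb_I01 : mu I = 1%E.
Proof.
by rewrite /I01 lebesgue_measure_itv/= lte01 oppr0 adde0.
Qed.
Hint Resolve measurable_I01 : core.

Lemma integrable_sqr f : L2 f -> mu.-integrable I (fun x => (f x ^+ 2)%:E).
Proof.
move=> [mf f2]; apply/integrableP; split.
  apply/measurable_EFinP; exact: measurable_funX.
by under eq_integral do rewrite gee0_abs ?lee_fin ?sqr_ge0//.
Qed.

Lemma integrable_mul f g : L2 f -> L2 g ->
  mu.-integrable I (EFin \o (fun x => f x * g x)).
Proof.
move=> Lf Lg; have := integrableD measurable_I01 (integrable_sqr Lf) (integrable_sqr Lg).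
apply: le_integrable => //.
  by apply/measurable_EFinP; apply: measurable_funM; [case: Lf|case: Lg].
move=> x _ /=; rewrite lee_fin [leRHS]ger0_norm ?addr_ge0 ?sqr_ge0//.
rewrite normrM.
have := sqr_ge0 (`|f x| - `|g x|); rewrite sqrrB !real_normK ?num_real// => h1.
have := sqr_ge0 (`|f x|); have := sqr_ge0 (`|g x|); rewrite !real_normK ?num_real//; lra.
Qed.

Lemma L2_dominated f g : measurable_fun I f -> L2 g ->
  (forall x, I x -> `|f x| <= `|g x|) -> L2 f.
Proof.
move=> mf [mg g2] fg; split=> //; apply: le_lt_trans g2.
apply: ge0_le_integral => //.
- by move=> x _; rewrite lee_fin sqr_ge0.
- by apply/measurable_EFinP; exact: measurable_funX.
- by apply/measurable_EFinP; exact: measurable_funX.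
move=> x Ix; rewrite lee_fin -(real_normK (num_real (f x))).
by rewrite -(real_normK (num_real (g x))) ler_sqr ?nnegrE ?fg.
Qed.

Lemma L2_cst (c : R) : L2 (fun=> c : R).
Proof.
split=> //; rewrite integral_cst//= leb_I01 mule1; exact: ltry.
Qed.

Lemma L2D f g : L2 f -> L2 g -> L2 (fun x => f x + g x).
Proof.
move=> Lf Lg; have [mf _] := Lf; have [mg _] := Lg.
split; first exact: measurable_funD.
apply: (@le_lt_trans _ _ (\int[mu]_(x in I)
    ((f x ^+ 2)%:E + (g x ^+ 2)%:E + (f x ^+ 2)%:E + (g x ^+ 2)%:E))%E).
  apply: ge0_le_integral => //.
  - by move=> x _; rewrite lee_fin sqr_ge0.
  - by apply/measurable_EFinP; apply: measurable_funX; exact: measurable_funD.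
  - apply/measurable_EFinP; do !(apply: measurable_funD) => //; exact: measurable_funX.
  move=> x _; rewrite -!EFinD lee_fin.
  have := sqr_ge0 (f x - g x); rewrite sqrrB sqrrD; lra.
apply: integrable_lty => //; do !(apply: integrableD) => //; exact: integrable_sqr.
Qed.

Lemma L2Z a f : L2 f -> L2 (fun x => a * f x).
Proof.
move=> Lf; split; first by apply: measurable_funM => //; case: Lf.
have -> : (fun x => ((a * f x) ^+ 2)%:E) = (fun x => (a ^+ 2)%:E * (f x ^+ 2)%:E)%E.
  by apply/funext => x; rewrite -EFinM exprMn.
apply: integrable_lty => //; apply: integrableZl => //; exact: integrable_sqr.
Qed.

Lemma L2_semi_inner : semi_inner (V := R -> R^o) (@L2 R) (@ip R).
Proof.
split.
- exact: (L2_cst 0).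
- exact: L2D.
- exact: L2Z.
- by move=> f g; apply: eq_Rintegral => x _; rewrite mulrC.
- move=> f g h Lf Lg Lh; rewrite /ip -RintegralD//; try exact: integrable_mul.
  by apply: eq_Rintegral => x _; rewrite -mulrDl.
- move=> a f g Lf Lg; rewrite /ip -RintegralZl//; last exact: integrable_mul.
  by apply: eq_Rintegral => x _; rewrite mulrA.
- by move=> f; apply: Rintegral_ge0 => x _; rewrite -expr2 sqr_ge0.
Qed.

Lemma nrm_sqrE f : L2 f -> ((nrm f ^+ 2)%:E = \int[mu]_(x in I) (f x ^+ 2)%:E)%E.
Proof.
move=> Lf; rewrite /nrm sqr_sqrtr; last exact: (si_ge0 L2_semi_inner).
rewrite /ip /Rintegral fineK; last exact: integrable_fin_num (integrable_mul Lf Lf).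
by [].
Qed.

End L2Space.
#[global] Hint Resolve measurable_I01 : core.

(** * Completeness of L^2 (Riesz-Fischer) *)

Section RieszFischer.
Variable R : realType.
Local Notation mu := (@lebesgue_measure R).
Local Notation I := (@I01 R : set (measurableTypeR R)).
Local Notation hS := (@L2_semi_inner R).

Lemma L2_norm (f : R -> R) : L2 f -> L2 (fun x => `|f x|).
Proof.
move=> Lf; apply: (L2_dominated _ Lf) => [|x _]; last by rewrite normr_id.
by apply: measurableT_comp => //; case: Lf.
Qed.

Lemma nrm_cst1 : nrm (fun=> 1 : R) = 1.
Proof.
rewrite /nrm /ip Rintegral_cst/=; last exact: measurable_I01.
by rewrite [X in fine X]leb_I01/= !mul1r sqrtr1.
Qed.

(** Cauchy-Schwarz against the constant 1, which has norm 1 on the unit interval. *)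
Lemma integral_norm_le_nrm (f : R -> R) : L2 f ->
  (\int[mu]_(x in I) `|f x|%:E <= (nrm f)%:E)%E.
Proof.
move=> Lf; have Lnf := L2_norm Lf; have L1 := L2_cst (1 : R).
have hint := integrable_mul Lnf L1.
have -> : (\int[mu]_(x in I) `|f x|%:E)%E = (ip (fun x => `|f x|) (fun=> 1))%:E.
  rewrite /ip /Rintegral fineK; last exact: integrable_fin_num hint.
  by apply: eq_integral => x _; rewrite mulr1.
rewrite lee_fin; apply: le_trans (ler_norm _) _.
apply: le_trans (cauchy_schwarz hS Lnf L1) _.
rewrite -[seminorm _ (fun=> 1)]/(nrm (fun=> 1 : R)) nrm_cst1 mulr1.
rewrite le_eqVlt; apply/orP; left; apply/eqP.
rewrite /nrm /ip /seminorm; congr Num.sqrt.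
by apply: eq_Rintegral => x _; rewrite -normrM ger0_norm// -expr2 sqr_ge0.
Qed.

Lemma limn_einf_le (v : (\bar R)^nat) (c : \bar R) :
  (forall n, v n <= c)%E -> (limn_einf v <= c)%E.
Proof.
move=> vc; rewrite limn_einf_lim; apply: lime_le; first exact: is_cvg_einfs.
apply: nearW => n; apply: le_trans (vc n).
by apply: ereal_inf_lbound; exists n => /=.
Qed.

Lemma measurable_fun_limn_einf d (T : measurableType d) (D : set T)
    (f : (T -> \bar R)^nat) : (forall n, measurable_fun D (f n)) ->
  measurable_fun D (fun x => limn_einf (f ^~ x)).
Proof.
move=> mf; apply: measurableT_comp; first exact: oppe_measurable.
apply: (measurable_fun_limn_esup (f := fun n x => (- f n x)%E)) => n.
by apply: measurableT_comp => //; exact: oppe_measurable.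
Qed.

Lemma sum_half_le n : \sum_(0 <= k < n) (2^-1 : R) ^+ k <= 2.
Proof.
suff : \sum_(0 <= k < n) (2^-1 : R) ^+ k = 2 - 2 * 2^-1 ^+ n.
  by move=> ->; rewrite gerBl mulr_ge0// exprn_ge0.
elim: n => [|n IHn]; first by rewrite big_nil expr0 mulr1 subrr.
by rewrite big_nat_recr//= IHn exprS; field.
Qed.

Lemma cvgn_sum_dist (u : R^nat) (c : R) :
  (forall n, \sum_(0 <= k < n) `|u k.+1 - u k| <= c) -> cvgn u.
Proof.
move=> uc; have h : cvgn (series (fun k => u k.+1 - u k)).
  apply: normed_cvg; apply: nondecreasing_is_cvgn.
    by apply: nondecreasing_series => k _ _; exact: normr_ge0.
  by exists c => _ [n _ <-]; rewrite /series/=; exact: uc.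
have -> : u = (fun n => u 0%N + series (fun k => u k.+1 - u k) n).
  by apply/funext => n; rewrite /series/= telescope_sumr// addrC subrK.
by apply: is_cvgD => //; exact: is_cvg_cst.
Qed.

Section FastCauchy.
Variable u : nat -> R -> R.
Hypothesis Lu : forall n, L2 (u n).
Hypothesis u_cauchy : forall n m, (n <= m)%N ->
  nrm (fun x => u m x - u n x) <= 2^-1 ^+ n.

Let Lud n m : L2 (fun x => u m x - u n x).
Proof. exact: (siB hS). Qed.

Let mu_ n : measurable_fun I (u n). Proof. by case: (Lu n). Qed.

(** The sum of the |u_(k+1) - u_k| has integral at most the sum of the 2^-k, hence is finite almost
    everywhere, and there the sequence converges absolutely. *)
Lemma fast_cauchy_ae_cvg : {ae mu, forall x, I x -> cvgn (fun n => u n x)}.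
Proof.
pose G x := (\sum_(0 <= k <oo) `|u k.+1 x - u k x|%:E)%E.
have md k : measurable_fun I (fun x => `|u k.+1 x - u k x|%:E).
  apply/measurable_EFinP; apply: measurableT_comp => //.
  exact: measurable_funB.
have mG : measurable_fun I G by apply: ge0_emeasurable_sum.
have G0 x : (0 <= G x)%E by apply: nneseries_ge0.
have Gint : mu.-integrable I G.
  apply/integrableP; split=> //; under eq_integral do rewrite gee0_abs//.
  rewrite integral_nneseries//.
  apply: (@le_lt_trans _ _ 2%:E); last exact: ltry.
  apply: lime_le; first by apply: is_cvg_nneseries => n _ _; exact: integral_ge0.
  apply: nearW => n.
  apply: (@le_trans _ _ (\sum_(0 <= k < n) ((2^-1 : R) ^+ k)%:E)%E).
    apply: lee_sum => k _; apply: le_trans (integral_norm_le_nrm (Lud _ _)) _.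
    by rewrite lee_fin u_cauchy.
  by rewrite sumEFin lee_fin sum_half_le.
have := integrable_ae (@measurable_I01 R) Gint.
apply: filterS => x Gx Ix; have Gfin := Gx Ix.
apply: (@cvgn_sum_dist _ (fine (G x))) => n.
rewrite -lee_fin fineK// -sumEFin.
exact: nneseries_lim_ge.
Qed.

(** The upper limit is measurable and defined everywhere; its values on the null set of divergence
    are irrelevant. *)
Let f x := fine (limn_esup (fun n => (u n x)%:E)).

Let mf : measurable_fun I f.
Proof.
apply: measurableT_comp; first exact: fine_measurable.
apply: measurable_fun_limn_esup => n; exact/measurable_EFinP.
Qed.

Let f_lim : {ae mu, forall x, I x -> (fun n => u n x) @ \oo --> f x}.
Proof.
have := fast_cauchy_ae_cvg; apply: filterS => x h Ix.
have /cvg_ex[l ul] := h Ix.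
have ule : (fun n => (u n x)%:E) @ \oo --> l%:E.
  by apply: cvg_EFin; [exact: nearW|exact: ul].
by rewrite /f (cvg_limn_einf_sup ule).2.
Qed.

Let f_close n : (\int[mu]_(x in I) ((u n x - f x) ^+ 2)%:E <= ((2^-1 ^+ n) ^+ 2)%:E)%E.
Proof.
(* Fatou's lemma is applied to this sequence; the shift by [n] makes the Cauchy estimate hold for
   every [k]. *)
pose g k x := ((u (n + k)%N x - u n x) ^+ 2)%:E.
have mg k : measurable_fun I (g k).
  apply/measurable_EFinP; apply: measurable_funX; exact: measurable_funB.
have g0 k x : (0 <= g k x)%E by rewrite lee_fin sqr_ge0.
have -> : (\int[mu]_(x in I) ((u n x - f x) ^+ 2)%:E =
           \int[mu]_(x in I) limn_einf (g ^~ x))%E.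
  apply: ae_eq_integral => //.
  - by apply/measurable_EFinP; apply: measurable_funX; exact: measurable_funB.
  - exact: measurable_fun_limn_einf.
  have := f_lim; apply: filterS => x h Ix; have ul := h Ix.
  suff /cvg_limn_einf_sup[-> _] : (g ^~ x) @ \oo --> ((u n x - f x) ^+ 2)%:E by [].
  apply: cvg_EFin; first exact: nearW.
  have -> : fine \o g^~ x = (fun k => (u (k + n)%N x - u n x) ^+ 2).
    by apply/funext => k; rewrite /g /= addnC.
  rewrite -sqrrN opprB expr2; under eq_fun do rewrite expr2.
  have ul' : (fun k => u (k + n)%N x) @ \oo --> f x.
    by rewrite (cvg_shiftn n (fun k => u k x)).
  by apply: cvgM; apply: cvgB => //; exact: cvg_cst.
apply: le_trans (fatou mu (@measurable_I01 R) mg _) _ => //.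
apply: limn_einf_le => k; rewrite /g -(nrm_sqrE (Lud n (n + k)%N)) lee_fin.
by rewrite ler_sqr ?nnegrE ?sqrtr_ge0 ?exprn_ge0// u_cauchy// leq_addr.
Qed.

Lemma fast_cauchy_L2_cvg : exists f, L2 f /\
  forall n, nrm (fun x => u n x - f x) <= 2^-1 ^+ n.
Proof.
have Lfn n : L2 (fun x => u n x - f x).
  split; first exact: measurable_funB (mu_ n) mf.
  by apply: le_lt_trans (f_close n) _; exact: ltry.
exists f; split.
  (* [f] is square integrable as the difference of [u 0] and [u 0 - f]. *)
  have := siB hS (Lu 0%N) (Lfn 0%N); congr L2; apply/funext => x /=.
  by rewrite !fctE opprB addrC subrK.
move=> n; rewrite -ler_sqr ?nnegrE ?sqrtr_ge0 ?exprn_ge0//.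
by rewrite -lee_fin nrm_sqrE.
Qed.

End FastCauchy.

Lemma L2_fast_complete : fast_complete (V := R -> R^o) (@L2 R) (@ip R).
Proof. move=> u Lu uc; exact: fast_cauchy_L2_cvg. Qed.

End RieszFischer.

(** * Integral operators with graphon kernels *)

Section Kernel.
Variable R : realType.
Local Notation mu := (@lebesgue_measure R).
Local Notation I := (@I01 R : set (measurableTypeR R)).
Local Notation hS := (@L2_semi_inner R).
Lemma nrm_le_on (f : R -> R) (c : R) : L2 f -> 0 <= c ->
  (forall x, I x -> `|f x| <= c) -> nrm f <= c.
Proof.
move=> Lf c0 fc; rewrite -ler_sqr ?nnegrE ?sqrtr_ge0// -lee_fin nrm_sqrE//.
apply: (@le_trans _ _ (\int[mu]_(x in I) (c ^+ 2)%:E)%E).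
  apply: ge0_le_integral => //.
  - by move=> y _; rewrite lee_fin sqr_ge0.
  - by apply/measurable_EFinP; apply: measurable_funX; case: Lf.
  move=> y Iy; rewrite lee_fin -(real_normK (num_real (f y))) ler_sqr ?nnegrE//.
  exact: fc.
by rewrite integral_cst// [X in (_ * X)%E]leb_I01 mule1.
Qed.

Variable W : R -> R -> R.
Hypothesis hW : graphon W.

Lemma graphon_norm_le1 x y : I x -> I y -> `|W x y| <= 1.
Proof.
move=> Ix Iy; have [_ [W01 _]] := hW; have /andP[W0 W1] := W01 _ _ Ix Iy.
by rewrite ger0_norm.
Qed.

Let mW : measurable_fun (I `*` I)
  (fun p : measurableTypeR R * measurableTypeR R => W p.1 p.2).
Proof. by case: hW. Qed.

Let mI2 : measurable (I `*` I). Proof. exact: measurableX. Qed.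

Lemma measurable_fun_section x : I x -> measurable_fun I (W x).
Proof.
move=> Ix.
pose px (y : measurableTypeR R) : measurableTypeR R * measurableTypeR R := (x, y).
have mp : measurable_fun I px by apply: measurable_funTS; exact: pair1_measurable.
apply: (measurable_comp mI2 _ mW mp).
by move=> _ [y Iy <-].
Qed.

Lemma L2_section x : I x -> L2 (W x).
Proof.
move=> Ix; apply: (L2_dominated (measurable_fun_section Ix) (L2_cst 1)).
by move=> y Iy; rewrite normr1 graphon_norm_le1.
Qed.

Lemma nrm_section_le1 x : I x -> nrm (W x) <= 1.
Proof.
by move=> Ix; apply: (nrm_le_on (L2_section Ix)) => // y; exact: graphon_norm_le1.
Qed.

(** Cauchy-Schwarz against the section [W x]. The bound is pointwise, so it yields integrability for
    Fubini, membership in L^2 and contractivity of [K W]. *)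
Lemma K_norm_le (f : R -> R) x : I x -> L2 f -> `|K W f x| <= nrm f.
Proof.
move=> Ix Lf; apply: le_trans (cauchy_schwarz hS (L2_section Ix) Lf) _.
by rewrite ler_piMl ?sqrtr_ge0// nrm_section_le1.
Qed.

(** Extension by 0 puts the form on the whole product space, where Fubini is applied. Integrating
    out the second variable leaves [K W f] times [g]. *)
Definition kernel_form (f g : R -> R)
    (p : measurableTypeR R * measurableTypeR R) : \bar R :=
  ((fun p => (W p.1 p.2 * f p.2 * g p.1)%:E) \_ (I `*` I)) p.

Section Form.
Variables f g : R -> R.
Hypotheses (Lf : L2 f) (Lg : L2 g).
Local Notation F := (kernel_form f g).

Lemma kernel_form_measurable : measurable_fun setT F.
Proof.
apply/(measurable_restrictT _ mI2)/measurable_EFinP.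
apply: measurable_funM; first apply: measurable_funM => //.
  have mf : measurable_fun I (f : measurableTypeR R -> R) by case: Lf.
  have m2 : measurable_fun (I `*` I) (@snd (measurableTypeR R) (measurableTypeR R)).
    exact: measurable_funTS measurable_snd.
  have hsub : [set snd p | p in I `*` I] `<=` I by move=> _ [[x y] [/= _ Iy] <-].
  exact: measurable_comp (@measurable_I01 R) hsub mf m2.
have mg : measurable_fun I (g : measurableTypeR R -> R) by case: Lg.
have m1 : measurable_fun (I `*` I) (@fst (measurableTypeR R) (measurableTypeR R)).
  exact: measurable_funTS measurable_fst.
apply: (measurable_comp (@measurable_I01 R) _ mg m1).
by move=> _ [[x y] [/= Ix _] <-].
Qed.

Lemma kernel_form_int_snd (x : measurableTypeR R) :
  (\int[mu]_y F (x, y) = ((fun x => (K W f x * g x)%:E) \_ I) x)%E.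
Proof.
rewrite /patch; case: ifPn => [/set_mem Ix|nIx].
  have hint : mu.-integrable I (EFin \o (fun y => W x y * f y)).
    exact: integrable_mul (L2_section Ix) Lf.
  rewrite /K EFinM fineK; last exact: integrable_fin_num hint.
  rewrite muleC -integralZl// [RHS]integral_mkcond.
  apply: eq_integral => y _; rewrite /F /patch.
  case: (boolP (y \in I)) => Iy.
    by rewrite mem_set/=; [rewrite -EFinM mulrC|split=> //; exact: set_mem].
  by rewrite ifN//; apply: contraNN Iy => /set_mem[_ Iy]; exact: mem_set.
apply: integral0_eq => y _; rewrite /F /patch ifN//.
by apply: contraNN nIx => /set_mem[Ix _]; exact: mem_set.
Qed.

End Form.

Lemma kernel_form_sym (f g : R -> R) x y :
  kernel_form f g (x, y) = kernel_form g f (y, x).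
Proof.
rewrite /kernel_form /patch; case: (boolP ((x, y) \in I `*` I)).
  move=> /set_mem[/= Ix Iy]; rewrite mem_set//=.
  by have [_ [_ Wsym]] := hW; rewrite (Wsym x y)// mulrAC.
move=> nI; rewrite ifN//; apply: contraNN nI => /set_mem[/= Iy Ix].
exact: mem_set.
Qed.

Lemma kernel_form_norm (f g : R -> R) p :
  `|kernel_form f g p|%E = kernel_form (fun x => `|f x|) (fun x => `|g x|) p.
Proof.
rewrite /kernel_form /patch; case: ifPn => [/set_mem[/= Ix Iy]|_].
  have [_ [W01 _]] := hW; have /andP[W0 _] := W01 _ _ Ix Iy.
  by rewrite /= !normrM (ger0_norm W0).
by rewrite abse0.
Qed.

(** Tonelli: since W >= 0, the inner integral of the absolute value is K|f| times |g|, which is at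
    most a constant times |g|. *)
Lemma kernel_form_integrable (f g : R -> R) : L2 f -> L2 g ->
  (mu \x mu)%E.-integrable setT (kernel_form f g).
Proof.
move=> Lf Lg; have Lnf := L2_norm Lf; have Lng := L2_norm Lg.
have mF := kernel_form_measurable Lf Lg.
have mnF := kernel_form_measurable Lnf Lng.
apply/(integrable12ltyP mu mu mF).
pose bnd := (fun x => (nrm (fun x => `|f x|) * `|g x|)%:E) \_ I.
have ibnd : mu.-integrable I (EFin \o (fun x => nrm (fun x => `|f x|) * `|g x|)).
  apply: (integrable_mul (L2_cst _) Lng).
have mbnd : measurable_fun setT bnd.
  have := measurable_int mu ibnd.
  by move=> /(measurable_restrictT _ (@measurable_I01 R)).
apply: (@le_lt_trans _ _ (\int[mu]_x bnd x)%E); last first.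
  by rewrite /bnd -integral_mkcond; exact: integrable_lty.
apply: ge0_le_integral => //.
- by move=> x _; exact: integral_ge0.
- apply: (measurable_fun_fubini_tonelli_F (abse \o kernel_form f g)).
    exact: measurableT_comp.
  by move=> p; exact: abse_ge0.
move=> x _; under eq_integral do rewrite kernel_form_norm.
rewrite kernel_form_int_snd//; rewrite /bnd /patch; case: ifPn => // /set_mem Ix.
rewrite lee_fin ler_wpM2r//; apply: le_trans (ler_norm _) _.
exact: K_norm_le.
Qed.

(** Fubini includes measurability of the partial integral; with g = 1 this integral is [K W f]. *)
Lemma K_measurable (f : R -> R) : L2 f -> measurable_fun I (K W f).
Proof.
move=> Lf; have L1 := L2_cst (1 : R).
have mF := measurable_fubini_F (kernel_form_integrable Lf L1).
apply/measurable_EFinP/(measurable_restrictT _ (@measurable_I01 R)).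
apply: eq_measurable_fun mF => x _.
rewrite /fubini_F kernel_form_int_snd//.
by rewrite /patch; case: ifPn => //; rewrite mulr1.
Qed.

Lemma L2_K (f : R -> R) : L2 f -> L2 (K W f).
Proof.
move=> Lf; apply: (L2_dominated (K_measurable Lf) (L2_cst (nrm f))).
by move=> x Ix; rewrite [leRHS]ger0_norm ?sqrtr_ge0 ?K_norm_le.
Qed.

Lemma K_sym (f g : R -> R) : L2 f -> L2 g -> ip (K W f) g = ip f (K W g).
Proof.
move=> Lf Lg; congr fine; have := Fubini (kernel_form_integrable Lf Lg).
have E (h k : R -> R) : L2 h -> (\int[mu]_x \int[mu]_y kernel_form h k (x, y))%E =
    (\int[mu]_(x in I) (K W h x * k x)%:E)%E.
  move=> Lh; rewrite [RHS]integral_mkcond; apply: eq_integral => x _.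
  by rewrite kernel_form_int_snd.
rewrite E// => ->.
have -> : (\int[mu]_y \int[mu]_x kernel_form f g (x, y))%E =
    (\int[mu]_y \int[mu]_x kernel_form g f (y, x))%E.
  by apply: eq_integral => y _; apply: eq_integral => x _; exact: kernel_form_sym.
by rewrite E//; apply: eq_integral => x _; rewrite mulrC.
Qed.

Lemma nrm_K_le (f : R -> R) : L2 f -> nrm (K W f) <= nrm f.
Proof.
move=> Lf; apply: nrm_le_on; [exact: L2_K|exact: sqrtr_ge0|move=> x Ix].
exact: K_norm_le.
Qed.

(** A graphon is constrained on the unit square only, so identities for [K W f] hold at points of
    the interval; [eq_nrm] turns them into identities of seminorms. *)
Lemma KD (f g : R -> R) x : I x -> L2 f -> L2 g ->
  K W (fun x => f x + g x) x = K W f x + K W g x.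
Proof.
by move=> Ix Lf Lg; exact: (si_addr hS Lf Lg (L2_section Ix)).
Qed.

Lemma KZ a (f : R -> R) x : I x -> L2 f -> K W (fun x => a * f x) x = a * K W f x.
Proof. by move=> Ix Lf; exact: (si_scaler hS a Lf (L2_section Ix)). Qed.

End Kernel.

(** * Eigenspaces and spectral sums *)

Section Eigen.
Variable R : realType.
Local Notation mu := (@lebesgue_measure R).
Local Notation I := (@I01 R : set (measurableTypeR R)).
Local Notation hS := (@L2_semi_inner R).

Lemma eq_nrm (f g : R -> R) : (forall x, I x -> f x = g x) -> nrm f = nrm g.
Proof.
move=> fg; congr Num.sqrt; apply: eq_Rintegral => x /set_mem Ix.
by rewrite (fg _ Ix).
Qed.

Lemma nrm_add_eq0 (f g : R -> R) : L2 f -> L2 g -> nrm f = 0 -> nrm g = 0 ->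
  nrm (fun x => f x + g x) = 0.
Proof.
move=> Lf Lg f0 g0; apply/eqP; rewrite eq_le sqrtr_ge0 andbT.
by apply: le_trans (nmD hS Lf Lg) _; rewrite -[leLHS]/(nrm f + nrm g) f0 g0 addr0.
Qed.

Variable W : R -> R -> R.
Hypothesis hW : graphon W.

Lemma L2_Kshift l (f : R -> R) : L2 f -> L2 (Kshift W l f).
Proof.
by move=> Lf; apply: (siB hS (L2_K hW Lf)); exact: L2Z.
Qed.

Lemma nrm_Kshift_le l (f : R -> R) : L2 f -> nrm (Kshift W l f) <= (1 + `|l|) * nrm f.
Proof.
move=> Lf; have LlF : L2 (fun x => - (l * f x)) by exact: (siN hS (L2Z l Lf)).
apply: le_trans (nmD hS (L2_K hW Lf) LlF) _.
rewrite mulrDl mul1r lerD ?nrm_K_le//.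
by rewrite (nmN hS (L2Z l Lf)) (nmZ hS l Lf).
Qed.

Lemma nrm_KshiftD l (f g : R -> R) : L2 f -> L2 g ->
  nrm (Kshift W l (fun x => f x + g x)) <=
  nrm (Kshift W l f) + nrm (Kshift W l g).
Proof.
move=> Lf Lg; apply: le_trans (nmD hS (L2_Kshift l Lf) (L2_Kshift l Lg)).
rewrite le_eqVlt; apply/orP; left; apply/eqP; apply: eq_nrm => x Ix.
by rewrite /Kshift !fctE KD// mulrDr opprD addrACA.
Qed.

Lemma nrm_KshiftZ l a (f : R -> R) : L2 f ->
  nrm (Kshift W l (fun x => a * f x)) = `|a| * nrm (Kshift W l f).
Proof.
move=> Lf; rewrite -[RHS](nmZ hS a (L2_Kshift l Lf)); apply: eq_nrm => x Ix.
by rewrite /Kshift KZ// mulrCA -mulrBr.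
Qed.

Lemma eigsp0 l : eigsp W l (fun=> 0).
Proof.
split; first exact: L2_cst.
apply/eqP; rewrite eq_le sqrtr_ge0 andbT.
by apply: le_trans (nrm_Kshift_le l (L2_cst 0)) _; rewrite (nm0 hS : nrm (fun=> 0) = 0) mulr0.
Qed.

Lemma eigspD l (f g : R -> R) : eigsp W l f -> eigsp W l g ->
  eigsp W l (fun x => f x + g x).
Proof.
move=> [Lf f0] [Lg g0]; split; first exact: L2D.
apply/eqP; rewrite eq_le sqrtr_ge0 andbT.
by apply: le_trans (nrm_KshiftD l Lf Lg) _; rewrite f0 g0 addr0.
Qed.

Lemma eigspZ l a (f : R -> R) : eigsp W l f -> eigsp W l (fun x => a * f x).
Proof.
by move=> [Lf f0]; split; [exact: L2Z|rewrite nrm_KshiftZ// f0 mulr0].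
Qed.

Lemma eigsp_closed l (u : nat -> R -> R) (f : R -> R) :
  (forall n, eigsp W l (u n)) -> L2 f ->
  (forall n, nrm (fun x => u n x - f x) <= 2^-1 ^+ n) -> eigsp W l f.
Proof.
move=> Eu Lf uf; split=> //; apply/eqP; rewrite eq_le sqrtr_ge0 andbT.
apply: (@le_geometric_half _ (1 + `|l|)) => n; have [Lu u0] := Eu n.
have Lfu : L2 (fun x => f x - u n x) by exact: (siB hS Lf Lu).
have -> : f = (fun x => (f x - u n x) + u n x).
  by apply/funext => x; rewrite subrK.
apply: le_trans (nrm_KshiftD l Lfu Lu) _; rewrite u0 addr0.
apply: le_trans (nrm_Kshift_le l Lfu) _; rewrite ler_wpM2l ?addr_ge0//.
by apply: le_trans (uf n); rewrite le_eqVlt (nmBC hS Lf Lu : nrm _ = nrm _) eqxx.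
Qed.

Lemma Pt_is_proj l : is_proj (eigsp W l) (Pt W l).
Proof.
apply: epsilon_spec.
(* [epsilon] is specified once a single map is exhibited; it comes from pointwise choice, with an
   arbitrary value outside L^2. *)
have h (f : R -> R) : exists g, L2 f -> eigsp W l g /\
    forall h, eigsp W l h -> ip (fun x => f x - g x) h = 0.
  have [Lf|nLf] := pselect (L2 f); last by exists f.
  have [|||||g [Eg gf]] := projection_exists hS (@L2_fast_complete R)
    (E := eigsp W l) _ _ _ _ _ Lf.
  - by move=> g [].
  - exact: eigsp0.
  - exact: eigspD.
  - exact: eigspZ.
  - exact: eigsp_closed.
  - by exists g.
have /choice[Q hQ] := h.
by exists Q.
Qed.

Lemma Pt_eigsp l (f : R -> R) : L2 f -> eigsp W l (Pt W l f).
Proof. by move=> /(Pt_is_proj l)[]. Qed.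

Lemma L2_Pt l (f : R -> R) : L2 f -> L2 (Pt W l f).
Proof. by move=> /(Pt_eigsp l)[]. Qed.

Lemma Pt_orth l (f g : R -> R) : L2 f -> eigsp W l g -> ip f g = ip (Pt W l f) g.
Proof.
move=> Lf Eg; have Lg : L2 g by case: Eg.
have [_ /(_ _ Eg)] := Pt_is_proj l Lf.
have -> : ip (fun x => f x - Pt W l f x) g = ip f g - ip (Pt W l f) g.
  rewrite -(si_oppl hS (L2_Pt l Lf) Lg).
  exact: (si_addl hS Lf (siN hS (L2_Pt l Lf)) Lg).
by move/eqP; rewrite subr_eq0 => /eqP.
Qed.

Lemma eigsp_ip l (f g : R -> R) : eigsp W l f -> L2 g ->
  ip (K W f) g = l * ip f g.
Proof.
move=> [Lf f0] Lg; have Llf := L2Z l Lf.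
have := nm_eq0_ip hS (L2_Kshift l Lf) Lg f0.
have -> : ip (Kshift W l f) g = ip (K W f) g - l * ip f g.
  rewrite -(si_scalel hS l Lf Lg) -(si_oppl hS Llf Lg).
  exact: (si_addl hS (L2_K hW Lf) (siN hS Llf) Lg).
by move/eqP; rewrite subr_eq0 => /eqP.
Qed.

Lemma eigsp_orth l m (f g : R -> R) : l != m -> eigsp W l f -> eigsp W m g ->
  ip f g = 0.
Proof.
move=> lm Ef Eg; have Lf : L2 f by case: Ef.
have Lg : L2 g by case: Eg.
have : ip (K W f) g = ip f (K W g) by exact: K_sym.
rewrite (eigsp_ip Ef Lg) (si_sym hS f (K W g)) (eigsp_ip Eg Lf) (si_sym hS g f).
by move/eqP; rewrite -subr_eq0 -mulrBl mulf_eq0 subr_eq0 (negPf lm) => /eqP.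
Qed.

(** [spec] means failure of bijectivity. Eigenvalues belong to it, and at all other points the
    projection [Pt] is null, so spectral sums are determined by the coefficients at eigenvalues. *)
Definition eigenvalue_of l := exists f, eigsp W l f /\ nrm f != 0.

Lemma eigenvalue_in_spec l : eigenvalue_of l -> spec W l.
Proof.
by move=> [f [[Lf f0] nf]] [inj _]; move/eqP: nf; apply; exact: inj.
Qed.

Lemma nrm_Pt_neq0 l (f : R -> R) : L2 f -> nrm (Pt W l f) != 0 -> eigenvalue_of l.
Proof. by move=> Lf h; exists (Pt W l f); split=> //; exact: Pt_eigsp. Qed.

(** The difference lies in the eigenspace and is orthogonal to it. *)
Lemma Pt_eigvec l (v : R -> R) : eigsp W l v ->
  nrm (fun x => Pt W l v x - v x) = 0.
Proof.
move=> Ev; have Lv : L2 v by case: Ev.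
have LP := L2_Pt l Lv.
have EB : eigsp W l (fun x => Pt W l v x - v x).
  have -> : (fun x => Pt W l v x - v x) = (fun x => Pt W l v x + (-1) * v x).
    by apply/funext => x; rewrite mulN1r.
  by apply: eigspD; [exact: Pt_eigsp|exact: eigspZ].
have LB : L2 (fun x => Pt W l v x - v x) by case: EB.
apply/eqP; rewrite -sqrf_eq0 (nm_sqr hS); apply/eqP.
rewrite [LHS](si_addl hS LP (siN hS Lv) LB) (si_oppl hS Lv LB).
by rewrite (Pt_orth Lv EB) subrr.
Qed.

Lemma Pt_eigvec_neq l m (v : R -> R) : l != m -> eigsp W l v -> nrm (Pt W m v) = 0.
Proof.
move=> lm Ev; have Lv : L2 v by case: Ev.
apply/eqP; rewrite -sqrf_eq0 (nm_sqr hS); apply/eqP.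
rewrite -(Pt_orth Lv (Pt_eigsp m Lv)); apply: (eigsp_orth lm) => //.
exact: Pt_eigsp.
Qed.

End Eigen.

(** * Square summability of eigenvalues and spectral sums *)

Section Spectral.
Variable R : realType.
Local Notation mu := (@lebesgue_measure R).
Local Notation I := (@I01 R : set (measurableTypeR R)).
Local Notation hS := (@L2_semi_inner R).

Lemma nrm_sub_eq0 (f g : R -> R) : L2 f -> L2 g ->
  nrm (fun x => f x - g x) = 0 -> nrm f = nrm g.
Proof.
move=> Lf Lg fg0; apply/eqP; rewrite eq_le; apply/andP; split.
  by have := nm_tri0 hS Lf Lg; rewrite (fg0 : seminorm _ (f - g) = 0) add0r.
have := nm_tri0 hS Lg Lf.
by rewrite (nmBC hS Lg Lf) (fg0 : seminorm _ (f - g) = 0) add0r.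
Qed.

Lemma sum_scale_fctE (T : Type) (s : seq T) (c : T -> R) (v : T -> R -> R) :
  (fun x => \sum_(i <- s) c i * v i x) = \sum_(i <- s) c i *: (v i : R -> R^o).
Proof. by apply/funext => x; rewrite fct_sumE. Qed.

Lemma L2_sum (T : Type) (s : seq T) (c : T -> R) (v : T -> R -> R) :
  (forall i, L2 (v i)) -> L2 (fun x => \sum_(i <- s) c i * v i x).
Proof.
by move=> Lv; rewrite sum_scale_fctE; apply: (si_sum hS) => i _; exact: L2Z.
Qed.

Variable W : R -> R -> R.
Hypothesis hW : graphon W.

Lemma unit_eigenvector l : eigenvalue_of W l ->
  exists v, eigsp W l v /\ nrm v = 1.
Proof.
move=> [f [Ef nf]]; exists (fun x => (nrm f)^-1 * f x); split.
  exact: eigspZ.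
have Lf : L2 f by case: Ef.
rewrite [LHS](nmZ hS _ Lf) ger0_norm ?invr_ge0 ?sqrtr_ge0//.
by rewrite mulVf.
Qed.

(* Bessel's inequality for the section W x against the eigenvectors,
   integrated over x *)
Lemma sum_sqr_eigenvalues_le1 (s : seq R) : uniq s ->
  (forall l, l \in s -> eigenvalue_of W l) -> \sum_(l <- s) l ^+ 2 <= 1.
Proof.
move=> us sE.
have /choice[e he] l : exists v, eigsp W l v /\ (eigenvalue_of W l -> nrm v = 1).
  have [/unit_eigenvector[v [Ev v1]]|nE] := pselect (eigenvalue_of W l).
    by exists v.
  by exists (fun=> 0); split=> //; exact: eigsp0.
have Ee l : eigsp W l (e l) by case: (he l).
have Le l : L2 (e l) by case: (Ee l).
have ptw x : I x -> \sum_(l <- s) K W (e l) x ^+ 2 <= 1.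
  move=> Ix; have Lx := L2_section hW Ix.
  (* [K W (e l) x] is the inner product of [W x] with [e l], so for an eigenvalue [l] this is the
     component of [W x] along [e l]. *)
  pose v l : R -> R^o := K W (e l) x *: (e l : R -> R^o).
  have Lv l : L2 (v l) by exact: L2Z.
  have vorth l m : l != m -> ip (v l) (v m) = 0.
    move=> lm; rewrite [LHS](si_scalel hS _ (Le l) (Lv m)).
    rewrite [X in _ * X](si_scaler hS _ (Le m) (Le l)).
    by rewrite (eigsp_orth hW lm (Ee l) (Ee m)) !mulr0.
  have nv l : l \in s -> nrm (v l) = `|K W (e l) x|.
    by move=> /sE El; rewrite [LHS](nmZ hS _ (Le l)) [X in _ * X](he l).2// mulr1.
  have vx l : l \in s -> ip (W x) (v l) = nrm (v l) ^+ 2.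
    move=> ls; rewrite nv// real_normK ?num_real//.
    by rewrite [LHS](si_scaler hS (K W (e l) x) (Le l) Lx) expr2.
  have := bessel hS Lv vorth Lx us vx.
  rewrite big_seq [X in _ -> X <= _]big_seq => hb.
  apply: (@le_trans _ _ (nrm (W x) ^+ 2)); last first.
    by rewrite expr_le1 ?sqrtr_ge0// nrm_section_le1.
  apply: le_trans hb; apply: ler_sum => l ls.
  by rewrite [X in _ <= X ^+ 2](nv l ls : seminorm _ _ = _) real_normK ?num_real.
have LK l : L2 (K W (e l)) by exact: L2_K.
have nK l : l \in s -> nrm (K W (e l)) ^+ 2 = l ^+ 2.
  move=> ls; have [_ e0] := Ee l.
  rewrite (nrm_sub_eq0 (LK l) (L2Z l (Le l)) e0).
  rewrite [X in X ^+ 2](nmZ hS l (Le l)) [X in _ * X](he l).2; last exact: sE.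
  by rewrite mulr1 real_normK ?num_real.
rewrite -lee_fin -sumEFin.
have -> : (\sum_(l <- s) (l ^+ 2)%:E =
    \sum_(l <- s) \int[mu]_(x in I) (K W (e l) x ^+ 2)%:E)%E.
  rewrite big_seq [RHS]big_seq; apply: eq_bigr => l ls.
  by rewrite -nK// nrm_sqrE.
rewrite -ge0_integral_sum//; last 2 first.
- move=> l; apply/measurable_EFinP; apply: measurable_funX.
  by case: (LK l).
- by move=> l x _; rewrite lee_fin sqr_ge0.
apply: (@le_trans _ _ (\int[mu]_(x in I) 1%:E)%E); last first.
  by rewrite integral_cst// [X in (_ * X)%E]leb_I01 mule1.
apply: ge0_le_integral => //.
- by move=> x _; apply: sume_ge0 => l _; rewrite lee_fin sqr_ge0.
- apply: emeasurable_sum => l; apply/measurable_EFinP; apply: measurable_funX.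
  by case: (LK l).
by move=> x Ix; rewrite sumEFin lee_fin ptw.
Qed.

(** Pigeonhole: cut the interval into n > 1 / d^2 open cells. An eigenvalue in each would give n
    distinct ones whose squares sum to at least n d^2 > 1. *)
Lemma eigenvalue_gap_away0 (p q d : R) : p < q -> 0 < d ->
  (forall l, p < l < q -> d <= `|l|) ->
  exists a e, [/\ 0 < e, p < a < q & forall l, eigenvalue_of W l -> e <= `|l - a|].
Proof.
move=> pq d0 dl.
pose n := (Num.truncn (d ^- 2)).+1.
have n0 : 0 < n%:R :> R by rewrite ltr0n.
pose h := (q - p) / n%:R; have h0 : 0 < h by rewrite divr_gt0// subr_gt0.
have hn : p + n%:R * h = q by rewrite /h mulrC divfK ?gt_eqF// addrC subrK.
have mono k m : (k <= m)%N -> p + k%:R * h <= p + m%:R * h.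
  by move=> km; rewrite lerD2l ler_wpM2r ?(ltW h0)// ler_nat.
have inpq k l : (k < n)%N -> p + k%:R * h < l < p + k.+1%:R * h -> p < l < q.
  move=> kn /andP[l1 l2]; apply/andP; split.
    by apply: le_lt_trans l1; have := mono _ _ (leq0n k); rewrite mul0r addr0.
  by apply: lt_le_trans l2 _; rewrite -hn; exact: mono.
have [k [kn hk]] : exists k, (k < n)%N /\
    forall l, eigenvalue_of W l -> ~ (p + k%:R * h < l < p + k.+1%:R * h).
  apply/not_existsP => H.
  have /choice[l hl] k : exists l, (k < n)%N ->
      eigenvalue_of W l /\ p + k%:R * h < l < p + k.+1%:R * h.
    have [kn|_] := boolP (k < n)%N; last by exists 0.
    apply: contrapT => H'; apply: (H k); split=> // l El hl.
    by apply: H'; exists l.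
  have ll k m : (k < m)%N -> (m < n)%N -> l k < l m.
    move=> km mn; have [_ /andP[_ h1]] := hl k (ltn_trans km mn).
    have [_ /andP[h2 _]] := hl m mn.
    by apply: lt_trans h1 _; apply: le_lt_trans h2; exact: mono.
  have : \sum_(x <- [seq l k | k <- iota 0 n]) x ^+ 2 <= 1.
    apply: sum_sqr_eigenvalues_le1.
      rewrite map_inj_in_uniq ?iota_uniq// => k m.
      rewrite !mem_iota !add0n => kn mn lkm.
      by case: (ltngtP k m) => // km; [have := ll _ _ km mn|have := ll _ _ km kn];
        rewrite lkm ltxx.
    by move=> x /mapP[k]; rewrite mem_iota add0n => kn ->; have [] := hl k kn.
  rewrite leNgt => /negP; apply; rewrite big_map.
  apply: (@lt_le_trans _ _ (\sum_(k <- iota 0 n) d ^+ 2)).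
    rewrite big_const_seq count_predT size_iota iter_addr_0.
    by rewrite -mulr_natl -ltr_pdivrMr ?exprn_gt0// mul1r truncnS_gt.
  rewrite big_seq [leRHS]big_seq; apply: ler_sum => k.
  rewrite mem_iota add0n => kn; have [_ hlk] := hl k kn.
  rewrite -(real_normK (num_real (l k))) ler_sqr ?nnegrE ?(ltW d0)//.
  by apply: dl; exact: inpq hlk.
(* The centre and half-width of a cell without eigenvalues. *)
exists (p + k%:R * h + h / 2), (h / 2); split; first by rewrite divr_gt0.
  by apply: (inpq k) => //; rewrite -[k.+1%:R]natr1 mulrDl mul1r; apply/andP; split; lra.
move=> l El; rewrite leNgt; apply/negP; rewrite ltr_norml => /andP[h1 h2].
by apply: (hk l El); rewrite -[k.+1%:R]natr1 mulrDl mul1r; apply/andP; split; lra.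
Qed.

Lemma eigenvalue_gap (p q : R) : p < q ->
  exists a e, [/\ 0 < e, p < a < q & forall l, eigenvalue_of W l -> e <= `|l - a|].
Proof.
move=> pq; have [q0|q0] := ltP 0 q.
  (* Points of ]p', q[ exceed p' > 0, so p' serves as [d]. *)
  pose p' := (Num.max p 0 + q) / 2.
  have mq : Num.max p 0 < q by rewrite gt_max pq.
  have pm : p <= Num.max p 0 by rewrite le_max lexx.
  have m0 : 0 <= Num.max p 0 by rewrite le_max lexx orbT.
  have p'q : p' < q by rewrite /p'; lra.
  have pp' : Num.max p 0 < p' by rewrite /p'; lra.
  have [|l /andP[pl lq]|a [e [e0 /andP[pa aq] h]]] :=
    @eigenvalue_gap_away0 p' q p' p'q.
  - lra.
  - by rewrite ger0_norm; lra.
  by exists a, e; split=> //; rewrite aq andbT; lra.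
(* Here p < q <= 0, and the left half of the interval stays at distance -(p + q) / 2 > 0 from 0. *)
have [|l /andP[pl lq]|a [e [e0 /andP[pa aq] h]]] :=
  @eigenvalue_gap_away0 p ((p + q) / 2) (- ((p + q) / 2)) (midf_lt pq).1.
- lra.
- by rewrite ler0_norm; lra.
by exists a, e; split=> //; rewrite pa/=; lra.
Qed.

(** All sums get the index set of all reals, with coefficient 0 outside the original one, so that
    projections and integrals can be combined linearly. *)
Definition eig_sum (c : R -> R) (Q : op R) := is_sot_sum setT c (Pt W) Q.

Lemma sot_sum_exists (S : set R) (c : R -> R) (M : R) :
  (forall l, eigenvalue_of W l -> `|c l| <= M) ->
  exists Q, is_sot_sum S c (Pt W) Q.
Proof.
move=> cM.
have h (f : R -> R) : exists q, L2 f -> L2 q /\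
    forall eps : R, 0 < eps -> exists s0 : seq R, uniq s0 /\ {subset s0 <= S} /\
      forall s : seq R, uniq s -> {subset s <= S} -> {subset s0 <= s} ->
        nrm (fun x => q x - \sum_(l <- s) c l * Pt W l f x) < eps.
  have [Lf|nLf] := pselect (L2 f); last by exists f.
  have [||||q [Lq hq]] := orthogonal_sum_exists hS (@L2_fast_complete R)
      (v := fun l => Pt W l f) _ _ S (c := c) (M := M) Lf.
  - by move=> l; exact: L2_Pt.
  - by move=> l m lm; apply: (eigsp_orth hW lm); exact: Pt_eigsp.
  - move=> l; rewrite (nm_sqr hS); apply: Pt_orth => //; exact: Pt_eigsp.
  - by move=> l /(nrm_Pt_neq0 hW Lf); exact: cM.
  exists q => _; split=> // eps /hq[s0 [us0 s0S hs0]].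
  exists s0; split=> //; split=> // s us sS ss; have := hs0 s us sS ss.
  by rewrite -sum_scale_fctE.
by have /choice[Q hQ] := h; exists Q.
Qed.

Lemma sot_sum_eig_sum (S : set R) (c : R -> R) (Q : op R) :
  is_sot_sum S c (Pt W) Q -> eig_sum (fun l => if l \in S then c l else 0) Q.
Proof.
move=> hQ f Lf; have [LQ h] := hQ f Lf; split=> // eps /h[s0 [us0 [s0S hs0]]].
exists s0; split=> //; split=> [l _|s us _ ss]; first exact: in_setT.
have := hs0 [seq l <- s | l \in S] (filter_uniq _ us).
have -> : (fun x => Q f x - \sum_(l <- s) (if l \in S then c l else 0) * Pt W l f x)
    = (fun x => Q f x - \sum_(l <- [seq l <- s | l \in S]) c l * Pt W l f x).
  apply/funext => x; congr (_ - _); rewrite big_filter [RHS]big_mkcond.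
  by apply: eq_bigr => l _; case: ifP => // _; rewrite mul0r.
apply=> l; rewrite mem_filter.
  by case/andP.
by move=> ls; rewrite s0S//= ss.
Qed.

Lemma eig_sum_lin (c d : R -> R) (a : R) (Q Q' : op R) :
  eig_sum c Q -> eig_sum d Q' ->
  eig_sum (fun l => c l + a * d l) (fun f x => Q f x + a * Q' f x).
Proof.
move=> hQ hQ' f Lf; have [LQ h] := hQ f Lf; have [LQ' h'] := hQ' f Lf.
have LaQ' := L2Z a LQ'.
split=> [|eps eps0]; first exact: L2D.
have a0 : 0 < `|a| + 1 by rewrite ltr_pwDr.
have [|s0 [us0 [_ hs0]]] := h (eps / 2); first by rewrite divr_gt0.
have [|s1 [us1 [_ hs1]]] := h' (eps / 2 / (`|a| + 1)).
  by rewrite !divr_gt0.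
exists (undup (s0 ++ s1)); split; first exact: undup_uniq.
split=> [l _|s us _ ss]; first exact: in_setT.
have hT l : l \in s -> l \in [set: R] by move=> _; exact: in_setT.
have ss0 : {subset s0 <= s} by move=> l ls; rewrite ss// mem_undup mem_cat ls.
have ss1 : {subset s1 <= s}.
  by move=> l ls; rewrite ss// mem_undup mem_cat ls orbT.
have h0 := hs0 s us hT ss0; have h1 := hs1 s us hT ss1.
have LP l : L2 (Pt W l f) by exact: L2_Pt.
pose A x := Q f x - \sum_(l <- s) c l * Pt W l f x.
pose B x := Q' f x - \sum_(l <- s) d l * Pt W l f x.
have LA : L2 A by apply: (siB hS LQ); exact: L2_sum.
have LB : L2 B by apply: (siB hS LQ'); exact: L2_sum.
have -> : (fun x => Q f x + a * Q' f x - \sum_(l <- s) (c l + a * d l) * Pt W l f x)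
    = (fun x => A x + a * B x).
  apply/funext => x; rewrite /A /B mulrBr addrACA -opprD mulr_sumr -big_split.
  by congr (_ - _); apply: eq_bigr => l _; rewrite mulrDl mulrA.
apply: le_lt_trans (nmD hS LA (L2Z a LB)) _.
rewrite [X in _ + X](nmZ hS a LB).
rewrite [ltRHS](splitr eps) ltr_leD//.
have := ltW h1; rewrite -/B ler_pdivlMr// => h1'.
apply: le_trans h1'; rewrite mulrC ler_wpM2l ?sqrtr_ge0//.
by rewrite lerDl.
Qed.

Lemma eig_sum_bound (c : R -> R) (Q : op R) (M : R) (f : R -> R) : L2 f -> 0 <= M ->
  eig_sum c Q -> (forall l, eigenvalue_of W l -> `|c l| <= M) ->
  nrm (Q f) <= M * nrm f.
Proof.
move=> Lf M0 hQ cM; have [LQ h] := hQ f Lf.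
have LP l : L2 (Pt W l f) by exact: L2_Pt.
apply/ler_addgt0Pl => eps /h[s [us [_ hs]]].
have Lsum := L2_sum s c LP.
apply: le_trans (nm_tri0 hS LQ Lsum) _; apply: lerD.
  by apply: ltW; apply: hs => // l _; exact: in_setT.
have vorth l m : l != m -> ip (Pt W l f) (Pt W m f) = 0.
  by move=> lm; apply: (eigsp_orth hW lm); exact: Pt_eigsp.
have b : \sum_(l <- s) nrm (Pt W l f) ^+ 2 <= nrm f ^+ 2.
  apply: (bessel hS LP vorth Lf us) => l _.
  by rewrite (nm_sqr hS); apply: Pt_orth => //; exact: Pt_eigsp.
rewrite -ler_sqr ?nnegrE ?mulr_ge0 ?sqrtr_ge0// sum_scale_fctE.
have := nm_sum_le hS LP vorth us (c := c) (M := M).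
move=> /(_ (fun l _ hl => cM l (nrm_Pt_neq0 hW Lf hl))) hb.
apply: le_trans hb _; rewrite exprMn ler_wpM2l ?sqr_ge0//.
Qed.

(** Only the term at [l] survives on [v]. This gives the lower bound on an integral that detects
    eigenvalues near a point. *)
Lemma eig_sum_eigvec (c : R -> R) (Q : op R) l (v : R -> R) : eig_sum c Q ->
  eigsp W l v -> nrm (Q v) = `|c l| * nrm v.
Proof.
move=> hQ Ev; have Lv : L2 v by case: Ev.
have [LQ h] := hQ v Lv; have Lcv := L2Z (c l) Lv.
rewrite -[RHS](nmZ hS (c l) Lv); apply: nrm_sub_eq0 => //.
apply/eqP; rewrite eq_le sqrtr_ge0 andbT.
apply/ler_addgt0Pl => eps /h[s0 [us0 [_ hs0]]].
have LP m : L2 (Pt W m v) by exact: L2_Pt.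
(* Inserting [l] guarantees that its term occurs in the finite sum. *)
pose s := undup (l :: s0).
have us : uniq s by exact: undup_uniq.
have Lsum := L2_sum s c LP.
apply: le_trans (nm_tri hS LQ Lsum Lcv) _; apply: lerD.
  apply: ltW; apply: hs0 => // m; first by rewrite in_setT.
  by move=> ms; rewrite mem_undup inE ms orbT.
have LB : L2 (fun x => Pt W l v x - v x) := siB hS (LP l) Lv.
rewrite sum_scale_fctE (bigD1_seq l)//=; last by rewrite mem_undup mem_head.
rewrite addrAC.
set X := c l *: _ - _; set Y := \sum_(_ <- _ | _) _.
have X0 : nrm X = 0.
  have -> : X = c l *: ((fun x => Pt W l v x - v x) : R -> R^o).
    by rewrite scalerBr.
  by rewrite [LHS](nmZ hS (c l) LB) [X in _ * X](Pt_eigvec hW Ev) mulr0.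
have LX : L2 X by apply: (siB hS) => //; exact: L2Z.
have [LY Y0] : L2 Y /\ nrm Y = 0.
  apply: (big_ind (fun Y : R -> R^o => L2 Y /\ nrm Y = 0)).
  - by split; [exact: L2_cst|exact: (nm0 hS)].
  - by move=> g k [Lg g0] [Lk k0]; split; [exact: L2D|exact: nrm_add_eq0].
  move=> m ml; split; first exact: L2Z.
  by rewrite [LHS](nmZ hS _ (LP m)) [X in _ * X](Pt_eigvec_neq hW _ Ev) ?mulr0// eq_sym.
by rewrite [leLHS](nrm_add_eq0 LX LY X0 Y0).
Qed.

Definition bounded_on_eigenvalues (c : R -> R) :=
  exists M, forall l, eigenvalue_of W l -> `|c l| <= M.

Lemma intPW_eig_sum (c : R -> R) : bounded_on_eigenvalues c ->
  eig_sum (fun l => if l \in spec W then c l else 0) (intPW W c).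
Proof.
move=> [M cM]; apply: sot_sum_eig_sum; apply: epsilon_spec.
exact: sot_sum_exists cM.
Qed.

Lemma PW_eig_sum (A : set R) :
  eig_sum (fun l => if l \in spec W `&` A then 1 else 0) (PW W A).
Proof.
apply: sot_sum_eig_sum; apply: epsilon_spec.
by apply: (@sot_sum_exists _ _ 1) => l _; rewrite normr1.
Qed.

End Spectral.

(** * Step functions and trapezoids *)

Section RealFunctions.
Variable R : realType.
Implicit Types f : R -> R.

Lemma Cc_intro f (a b : R) : continuous f ->
  (forall x, f x != 0 -> a <= x <= b) -> Cc f.
Proof.
move=> cf fab; split=> //.
apply: (subclosed_compact _ (@segment_compact _ a b)); first exact: closed_closure.
have cl : closed `[a, b]%classic by exact: interval_closed.
rewrite [X in _ `<=` X]((closure_id _).1 cl); apply: closure_subset => x /= /fab.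
by rewrite in_itv.
Qed.

Lemma Cc_support f : Cc f -> exists M, forall x, M <= `|x| -> f x = 0.
Proof.
move=> [_ /compact_bounded[M [_ hM]]]; exists (M + 2) => x Mx.
apply/eqP/negPn/negP => fx.
have : `|x| <= M + 1.
  apply: hM; first by rewrite ltrDl.
  exact: subset_closure.
by move=> h; lra.
Qed.

Lemma Cc_bounded f : Cc f -> exists M, forall x, `|f x| <= M.
Proof.
move=> [cf cs]; have : compact (f @` closure [set x | f x != 0]).
  by apply: continuous_compact => //; exact: continuous_subspaceT.
move=> /compact_bounded[M [_ hM]]; exists (`|M| + 1) => x.
have M1 : M < `|M| + 1 by rewrite (le_lt_trans (ler_norm _))// ltrDl.
have [fx|fx] := eqVneq (f x) 0; first by rewrite fx normr0 addr_ge0.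
by apply: (hM _ M1); exists x => //; exact: subset_closure.
Qed.

(** Heine-Cantor via near-coverings. Only [x] is confined to the segment, so the modulus reaches
    across the end points. *)
Lemma continuous_unif_segment f (a b e : R) : continuous f -> 0 < e ->
  exists2 d, 0 < d &
    forall x y, a <= x <= b -> `|x - y| < d -> `|f x - f y| < e.
Proof.
move=> cf e0.
have /compact_near_coveringP cov := @segment_compact R a b.
have := cov _ (0^'+ : set_system R) (fun d x => forall y, `|x - y| < d -> `|f x - f y| < e).
have H x : `[a, b]%classic x -> \forall x' \near x & d \near (0 : R)^'+,
    forall y, `|x' - y| < d -> `|f x' - f y| < e.
  move=> _.
  have e2 : 0 < e / 2 by rewrite divr_gt0.
  have /cvgrPdist_lt/(_ _ e2)/nbhs_ballP[r /= r0 hr] := cf x.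
  have r2 : 0 < r / 2 by rewrite divr_gt0.
  exists (ball x (r / 2), [set d : R | d < r / 2]).
    by split=> /=; [exact: nbhsx_ballx|exact: nbhs_right_lt].
  move=> [x' d] [/= xx' dr] y x'y.
  have h1 : `|f x - f x'| < e / 2.
    by apply: hr; apply: (le_ball _ xx'); lra.
  have h2 : `|f x - f y| < e / 2.
    apply: hr; rewrite /ball/=; rewrite /ball/= in xx'.
    rewrite (_ : x - y = (x - x') + (x' - y)); last by rewrite addrA subrK.
    apply: le_lt_trans (ler_normD _ _) _; lra.
  rewrite (_ : f x' - f y = (f x - f y) - (f x - f x')); last by ring.
  apply: le_lt_trans (ler_normB _ _) _; lra.
move=> /(_ _ H) => hnear.
have [d [d0 hd]] : exists d : R, 0 < d /\
    `[a, b]%classic `<=` (fun x => forall y, `|x - y| < d -> `|f x - f y| < e).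
  have [d []] := filter_ex (filterI (nbhs_right_gt (0 : R)) hnear).
  by exists d.
by exists d => // x y xab; apply: hd; rewrite /= in_itv.
Qed.

Lemma Cc_unif_continuous f (e : R) : Cc f -> 0 < e ->
  exists2 d, 0 < d & forall x y, `|x - y| < d -> `|f x - f y| < e.
Proof.
move=> Cf e0; have [M hM] := Cc_support Cf.
(* With the margin 1 and a modulus at most 1, a point [x] outside this segment has its neighbours
   [y] outside the support as well. *)
have [d d0 hd] := @continuous_unif_segment f (- (`|M| + 1)) (`|M| + 1) e Cf.1 e0.
exists (Num.min d 1); first by rewrite lt_min d0 ltr01.
move=> x y; rewrite lt_min => /andP[xyd xy1].
have [xM|xM] := leP `|x| (`|M| + 1).
  by apply: hd => //; rewrite -ler_norml.
have yM : `|M| < `|y|.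
  have := ler_distD y x 0; rewrite !subr0 => h; lra.
have MM := ler_norm M.
by rewrite !hM ?subrr ?normr0//; lra.
Qed.

Definition step_sum f (a : nat -> R) (n : nat) (x : R) :=
  \sum_(0 <= k < n) f (a k) * (a k < x <= a k.+1)%R%:R.

Lemma step_sum_close f (a : nat -> R) (e : R) :
  (forall k, a k < a k.+1) ->
  (forall k x, a k < x <= a k.+1 -> `|f x - f (a k)| <= e) ->
  forall n x, [/\ a 0%N <= a n, a 0%N < x <= a n -> `|f x - step_sum f a n x| <= e
    & ~~ (a 0%N < x <= a n) -> step_sum f a n x = 0].
Proof.
move=> aS fe n x; elim: n => [|n [a0n IH1 IH2]].
  split=> //; last by rewrite /step_sum big_nil.
  by case/andP => h1 h2; move: (lt_le_trans h1 h2); rewrite ltxx.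
rewrite /step_sum big_nat_recr//= -/(step_sum f a n x).
split; first exact: le_trans a0n (ltW (aS n)).
  move=> /andP[a0x xn]; have [xan|xan] := leP x (a n).
    by rewrite mulr0 addr0 IH1// a0x xan.
  by rewrite xn mulr1 IH2 ?add0r ?fe ?xan// negb_and -ltNge xan orbT.
move=> h; rewrite IH2; last first.
  apply: contra h => /andP[-> /= xn]; exact: le_trans xn (ltW (aS n)).
have -> : (a n < x <= a n.+1) = false; last by rewrite mulr0 addr0.
apply/negbTE; apply: contra h => /andP[h1 ->]; rewrite andbT.
exact: le_lt_trans h1.
Qed.

Lemma Cc_step_approx f (D : set R) (e : R) : Cc f -> dense D -> 0 < e ->
  exists n (a : nat -> R), (forall k, D (a k)) /\
    forall x, `|f x - step_sum f a n x| <= e.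
Proof.
move=> Cf dD e0; have [M hM] := Cc_support Cf.
have [d d0 hd] := Cc_unif_continuous Cf e0.
(* Each [a k] is taken in a cell of length [h], so consecutive ones differ by less than 2 h <= d; h
   <= 1 puts [a 0] to the left of -|M|. *)
pose h := Num.min d 1 / 2.
have h0 : 0 < h by rewrite divr_gt0// lt_min d0 ltr01.
have hdd : h + h <= d.
  by rewrite /h -splitr ge_min lexx.
pose p k : R := - (`|M| + 1) + k%:R * h.
have pS k : p k.+1 = p k + h by rewrite /p -natr1 mulrDl mul1r addrA.
have /choice[a ha] k : exists a, D a /\ p k < a < p k.+1.
  have [||a [aO Da]] := dD `]p k, p k.+1[%classic.
  - exists (p k + h / 2) => /=; rewrite in_itv/= pS; apply/andP; split; lra.
  - exact: interval_open.
  by exists a; split=> //; move: aO; rewrite /= in_itv.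
have aS k : a k < a k.+1.
  have [_ /andP[_ h1]] := ha k; have [_ /andP[h2 _]] := ha k.+1.
  exact: lt_trans h1 h2.
have fe k x : a k < x <= a k.+1 -> `|f x - f (a k)| <= e.
  move=> /andP[x1 x2]; apply/ltW/hd.
  have [_ /andP[+ _]] := ha k; have [_ /andP[_]] := ha k.+1.
  rewrite !pS => h1 h2; rewrite ger0_norm; lra.
(* Chosen so that n h > 2|M| + 1, that is p n > |M|, beyond which [f] vanishes. *)
pose n := (Num.truncn ((`|M| + `|M| + 1) / h)).+1.
exists n, a; split=> [k|x]; first by have [] := ha k.
have [_ h1 h2] := step_sum_close aS fe n x.
have [/h1//|xn] := boolP (a 0%N < x <= a n).
rewrite (h2 xn) subr0; have MM := ler_norm M.
have -> : f x = 0; last by rewrite normr0 ltW.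
apply: hM; move: xn; rewrite negb_and -leNgt -ltNge => /orP[xa|xa].
  have [_ /andP[_]] := ha 0%N; rewrite pS /p mul0r addr0 => h3.
  have h1' : h <= 1 by rewrite /h; have : Num.min d 1 <= 1 by [rewrite ge_min lexx orbT]; lra.
  have M0 := normr_ge0 M.
  have : - x <= `|x| by rewrite -normrN ler_norm.
  lra.
have [_ /andP[h3 _]] := ha n.
have : (`|M| + `|M| + 1) / h < n%:R by exact: truncnS_gt.
rewrite ltr_pdivrMr// => h4.
have := ler_norm x; rewrite /p in h3; lra.
Qed.

(** The ramps of width [d] lie inside [a, b], so the function differs from the indicator of ]a, b]
    only within distance [d] of an end point. With end points a - e, a + e and d = e it is the tent
    at [a]. *)
Definition trapezoid (a b d x : R) : R :=
  Num.max 0 (Num.min 1 (Num.min ((x - a) / d) ((b - x) / d))).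

Lemma trapezoid_continuous a b d : continuous (trapezoid a b d).
Proof.
move=> x.
pose f y : R^o := (y - a) / d; pose g y : R^o := (b - y) / d.
have cf : {for x, continuous f}.
  by apply: cvgM; [apply: cvgB; [exact: cvg_id|exact: cvg_cst]|exact: cvg_cst].
have cg : {for x, continuous g}.
  by apply: cvgM; [apply: cvgB; [exact: cvg_cst|exact: cvg_id]|exact: cvg_cst].
have c1 : {for x, continuous (fun=> 1 : R^o)} by exact: cvg_cst.
have c0 : {for x, continuous (fun=> 0 : R^o)} by exact: cvg_cst.
exact: (continuous_max c0 (continuous_min c1 (continuous_min cf cg))).
Qed.

Lemma trapezoid_Cc a b d : 0 < d -> Cc (trapezoid a b d).
Proof.
move=> d0; apply: (@Cc_intro _ a b); first exact: trapezoid_continuous.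
move=> x; apply: contraNT; rewrite negb_and -!ltNge => h.
apply/eqP/max_idPl; rewrite !ge_min; apply/orP; right.
case/orP: h => h; apply/orP; [left|right];
  rewrite pmulr_lle0 ?invr_gt0// subr_le0 ltW//.
Qed.

Lemma trapezoid_indicator a b d x : 0 < d -> d <= `|x - a| -> d <= `|x - b| ->
  trapezoid a b d x = (a < x <= b)%R%:R.
Proof.
move=> d0; rewrite /trapezoid.
have dV : 0 < d^-1 by rewrite invr_gt0.
have low y : y <= - d -> y / d <= 0.
  by move=> yd; rewrite pmulr_lle0//; lra.
have high y : d <= y -> 1 <= y / d by move=> yd; rewrite ler_pdivlMr// mul1r.
have [xa|xa] := leP x a.
  rewrite ler0_norm ?subr_le0// => h _ /=; apply/max_idPl.
  by rewrite !ge_min low ?orbT//; lra.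
rewrite gtr0_norm ?subr_gt0// => h1; have [xb|xb] := leP x b.
  rewrite ler0_norm ?subr_le0// => h2 /=.
  have -> : Num.min 1 (Num.min ((x - a) / d) ((b - x) / d)) = 1.
    by apply/min_idPl; rewrite le_min !high//; lra.
  by apply/max_idPr.
rewrite gtr0_norm ?subr_gt0// => h2 /=; apply/max_idPl.
by rewrite !ge_min (low (b - x)) ?orbT//; lra.
Qed.

Lemma tent_eq0 a e x : 0 < e -> e <= `|x - a| -> trapezoid (a - e) (a + e) e x = 0.
Proof.
move=> e0 h; apply/max_idPl; rewrite !ge_min; apply/orP; right.
move: h; rewrite ler_normr => /orP[h|h]; apply/orP; [right|left];
  rewrite pmulr_lle0 ?invr_gt0//; lra.
Qed.

Lemma tent_ge_half a e x : 0 < e -> `|x - a| <= e / 2 ->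
  2^-1 <= trapezoid (a - e) (a + e) e x.
Proof.
move=> e0; rewrite ler_norml => /andP[h1 h2].
rewrite le_max !le_min; apply/orP; right; apply/and3P; split.
- by rewrite invf_le1// ler1n.
- by rewrite ler_pdivlMr//; lra.
- by rewrite ler_pdivlMr//; lra.
Qed.

End RealFunctions.

(** * Vague convergence *)

Section OperatorLimits.
Variable R : realType.
Local Notation hS := (@L2_semi_inner R).

Lemma opnorm_ub (T : op R) (f : R -> R) : L2 f -> nrm f <= 1 ->
  ((nrm (T f))%:E <= opnorm T)%E.
Proof. by move=> Lf f1; apply: ereal_sup_ubound; exists f. Qed.

Lemma opnorm_le (T : op R) (M : R) :
  (forall f, L2 f -> nrm f <= 1 -> nrm (T f) <= M) -> (opnorm T <= M%:E)%E.
Proof.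
by move=> h; apply: ge_ereal_sup => _ [f [Lf f1] <-]; rewrite lee_fin h.
Qed.

Variables (J : Type) (le : J -> J -> Prop).

Definition unit_ball_lim (A : J -> op R) (B : op R) := forall eps : R, 0 < eps ->
  exists i0, forall i, le i0 i -> forall f, L2 f -> nrm f <= 1 ->
    nrm (fun x => A i f x - B f x) < eps.

Lemma opnorm_limP (A : J -> op R) (B : op R) :
  opnorm_lim le A B <-> unit_ball_lim A B.
Proof.
split=> h eps eps0.
  have [i0 hi0] := h _ eps0; exists i0 => i /hi0 AB f Lf f1.
  by rewrite -lte_fin; apply: le_lt_trans AB; exact: (opnorm_ub (opsub (A i) B)).
(* A supremum of values below a bound may attain it; halving restores strictness. *)
have [|i0 hi0] := h (eps / 2); first by rewrite divr_gt0.
exists i0 => i /hi0 AB; apply: (@le_lt_trans _ _ (eps / 2)%:E).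
  by apply: opnorm_le => f Lf f1; apply: ltW; exact: AB.
by rewrite lte_fin; lra.
Qed.

Hypothesis le_directed : directed_set le.

Lemma directed_upper2 i j : exists k, forall m, le k m -> le i m /\ le j m.
Proof.
have [_ [_ [tr dir]]] := le_directed; have [k [ik jk]] := dir i j.
by exists k => m km; split; [exact: tr ik km|exact: tr jk km].
Qed.

Definition L2_op (T : op R) := forall f, L2 f -> L2 (T f).

Lemma unit_ball_lim_lin (A A' : J -> op R) (B B' : op R) (a : R) :
  (forall i, L2_op (A i)) -> (forall i, L2_op (A' i)) -> L2_op B -> L2_op B' ->
  unit_ball_lim A B -> unit_ball_lim A' B' ->
  unit_ball_lim (fun i f x => A i f x + a * A' i f x)
                (fun f x => B f x + a * B' f x).
Proof.
move=> LA LA' LB LB' hA hA' eps eps0.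
have a0 : 0 < `|a| + 1 by rewrite ltr_pwDr.
have [|i0 hi0] := hA (eps / 2); first by rewrite divr_gt0.
have [|i1 hi1] := hA' (eps / 2 / (`|a| + 1)); first by rewrite !divr_gt0.
have [k hk] := directed_upper2 i0 i1; exists k => i /hk[ii0 ii1] f Lf f1.
pose X x := A i f x - B f x; pose Y x := A' i f x - B' f x.
have LX : L2 X by apply: (siB hS); [exact: LA|exact: LB].
have LY : L2 Y by apply: (siB hS); [exact: LA'|exact: LB'].
have -> : (fun x => A i f x + a * A' i f x - (B f x + a * B' f x)) =
    (fun x => X x + a * Y x).
  by apply/funext => x; rewrite /X /Y; ring.
apply: le_lt_trans (nmD hS LX (L2Z a LY)) _.
rewrite [X in _ + X](nmZ hS a LY) [ltRHS](splitr eps).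
apply: ltr_leD; first exact: hi0.
have := ltW (hi1 i ii1 f Lf f1); rewrite -/Y ler_pdivlMr// => h1.
by apply: le_trans h1; rewrite mulrC ler_wpM2l ?sqrtr_ge0// lerDl.
Qed.

(** The last difference is oriented as [k - h] so that one comparison lemma serves both [Wn i] and
    [W0]. *)
Lemma nrm_chain (f g h k : R -> R) (e1 e2 e3 : R) : L2 f -> L2 g -> L2 h -> L2 k ->
  nrm (fun x => f x - g x) <= e1 -> nrm (fun x => g x - h x) < e2 ->
  nrm (fun x => k x - h x) <= e3 -> nrm (fun x => f x - k x) < e1 + e2 + e3.
Proof.
move=> Lf Lg Lh Lk fg gh kh.
apply: le_lt_trans (nm_tri hS Lf Lh Lk) _.
apply: ltr_leD; last by rewrite (nmBC hS Lh Lk).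
apply: le_lt_trans (nm_tri hS Lf Lg Lh) _.
by apply: ler_ltD.
Qed.

End OperatorLimits.

(** * Comparing spectral sums of one graphon *)

Section SpectralComparison.
Variable R : realType.
Local Notation hS := (@L2_semi_inner R).
Variables (W : R -> R -> R) (hW : graphon W).

Definition step_op (f : R -> R) (a : nat -> R) (n : nat) : op R := fun h x =>
  \sum_(0 <= k < n) f (a k) * PW W `]a k, a k.+1] h x.

Lemma step_op0 (f : R -> R) (a : nat -> R) : step_op f a 0 = fun h x => 0.
Proof.
by apply/funext => h; apply/funext => x; rewrite /step_op big_nil.
Qed.

Lemma step_opS (f : R -> R) (a : nat -> R) n : step_op f a n.+1 =
  fun h x => step_op f a n h x + f (a n) * PW W `]a n, a n.+1] h x.
Proof.
by apply/funext => h; apply/funext => x; rewrite /step_op big_nat_recr.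
Qed.

Lemma step_op_eig_sum (f : R -> R) (a : nat -> R) n :
  eig_sum W (fun l => \sum_(0 <= k < n)
      f (a k) * (if l \in spec W `&` `]a k, a k.+1] then 1 else 0))
    (step_op f a n).
Proof.
elim: n => [|n IHn].
  rewrite step_op0 => h Lh; split=> [|eps eps0]; first exact: L2_cst.
  exists [::]; split=> //; split=> // s _ _ _.
  rewrite (_ : (fun x => _) = fun=> 0); first by rewrite (nm0 hS : nrm (fun=> 0) = 0).
  apply/funext => x; rewrite big1 ?subrr// => l _.
  by rewrite big_nil mul0r.
have h := eig_sum_lin hW (f (a n)) IHn (PW_eig_sum hW `]a n, a n.+1]).
rewrite step_opS; under [X in eig_sum _ X]eq_fun do rewrite big_nat_recr//=.
exact: h.
Qed.

Lemma eig_sum_sub_bound (c d : R -> R) (Q Q' : op R) (M : R) : 0 <= M ->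
  eig_sum W c Q -> eig_sum W d Q' ->
  (forall l, eigenvalue_of W l -> `|c l - d l| <= M) ->
  forall f, L2 f -> nrm f <= 1 -> nrm (fun x => Q f x - Q' f x) <= M.
Proof.
move=> M0 hQ hQ' cd f Lf f1.
have hL := eig_sum_lin hW (-1) hQ hQ'.
have -> : (fun x => Q f x - Q' f x) = (fun x => Q f x + (-1) * Q' f x).
  by apply/funext => x; rewrite mulN1r.
have hb := eig_sum_bound hW Lf M0 hL.
apply: le_trans (hb _) _; first by move=> l El; rewrite mulN1r; exact: cd.
by rewrite ler_piMr.
Qed.

Lemma L2_eig_sum (c : R -> R) (Q : op R) : eig_sum W c Q -> L2_op Q.
Proof. by move=> hQ f /hQ[]. Qed.

Lemma L2_PW (A : set R) : L2_op (PW W A).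
Proof. exact: L2_eig_sum (PW_eig_sum hW A). Qed.

Lemma Cc_bounded_on (f : R -> R) : Cc f -> bounded_on_eigenvalues W f.
Proof. by move=> /Cc_bounded[M hM]; exists M. Qed.

Lemma L2_intPW (f : R -> R) : Cc f -> L2_op (intPW W f).
Proof. by move=> /Cc_bounded_on /(intPW_eig_sum hW); exact: L2_eig_sum. Qed.

(** The error [e] does not depend on [W], so one step function serves the whole net and its
    limit. *)
Lemma intPW_step_op_le (f : R -> R) (a : nat -> R) n (e : R) : Cc f -> 0 <= e ->
  (forall l, `|f l - step_sum f a n l| <= e) ->
  forall h, L2 h -> nrm h <= 1 ->
    nrm (fun x => intPW W f h x - step_op f a n h x) <= e.
Proof.
move=> Cf e0 fe.
apply: eig_sum_sub_bound e0 (intPW_eig_sum hW (Cc_bounded_on Cf))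
  (step_op_eig_sum f a n) _ => l El.
rewrite (mem_set (eigenvalue_in_spec El)); apply: le_trans (fe l).
rewrite le_eqVlt; apply/orP; left; apply/eqP; congr (`|_ - _|).
apply: eq_bigr => k _; congr (_ * _).
have -> : (l \in spec W `&` `]a k, a k.+1]) = (a k < l <= a k.+1).
  apply/idP/idP => [/set_mem[_]|h]; first by rewrite /= in_itv.
  by apply/mem_set; split; [exact: eigenvalue_in_spec|rewrite /= in_itv].
by case: ifP.
Qed.

Lemma PW_intPW_le0 (f : R -> R) (a b : R) : Cc f ->
  (forall l, eigenvalue_of W l -> f l = (a < l <= b)%R%:R) ->
  forall h, L2 h -> nrm h <= 1 ->
    nrm (fun x => PW W `]a, b] h x - intPW W f h x) <= 0.
Proof.
move=> Cf fab.
apply: eig_sum_sub_bound (lexx 0) (PW_eig_sum hW `]a, b])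
  (intPW_eig_sum hW (Cc_bounded_on Cf)) _ => l El.
rewrite (mem_set (eigenvalue_in_spec El)) (fab _ El).
have -> : (l \in spec W `&` `]a, b]) = (a < l <= b).
  apply/idP/idP => [/set_mem[_]|h]; first by rewrite /= in_itv.
  by apply/mem_set; split; [exact: eigenvalue_in_spec|rewrite /= in_itv].
by case: ifP; rewrite subrr normr0.
Qed.

Lemma nrm_intPW_eq0 (f : R -> R) : Cc f ->
  (forall l, eigenvalue_of W l -> f l = 0) ->
  forall h, L2 h -> nrm (intPW W f h) = 0.
Proof.
move=> Cf f0 h Lh; apply/eqP; rewrite eq_le sqrtr_ge0 andbT -(mul0r (nrm h)).
apply: (eig_sum_bound hW Lh (lexx 0) (intPW_eig_sum hW (Cc_bounded_on Cf))).
by move=> l El; rewrite f0// if_same normr0.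
Qed.

Lemma intPW_eigvec (f : R -> R) l v : Cc f -> eigsp W l v -> nrm v = 1 ->
  nrm (intPW W f v) = `|f l|.
Proof.
move=> Cf Ev v1.
rewrite (eig_sum_eigvec hW (intPW_eig_sum hW (Cc_bounded_on Cf)) Ev) v1 mulr1.
rewrite mem_set//; apply: eigenvalue_in_spec; exists v; split=> //.
by rewrite v1 oner_neq0.
Qed.

End SpectralComparison.

Section VagueConvergence.
Variables (R : realType) (J : Type) (le : J -> J -> Prop).
Variables (Wn : J -> R -> R -> R) (W0 : R -> R -> R).
Hypotheses (le_directed : directed_set le).
Hypotheses (hWn : forall i, graphon (Wn i)) (hW0 : graphon W0).
Local Notation hS := (@L2_semi_inner R).

Lemma vague_intPW_lim (f : R -> R) : vague_conv le Wn W0 -> Cc f ->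
  opnorm_lim le (fun i => intPW (Wn i) f) (intPW W0 f).
Proof.
move=> [D [dD PD]] Cf; apply/opnorm_limP => eps eps0.
have e3 : 0 < eps / 3 by rewrite divr_gt0.
have [n [a [Da fa]]] := Cc_step_approx Cf dD e3.
have Lstep W (hW : graphon W) m : L2_op (step_op W f a m).
  exact: L2_eig_sum (step_op_eig_sum hW f a m).
have : unit_ball_lim le (fun i => step_op (Wn i) f a n) (step_op W0 f a n).
  (* A step operator is a finite linear combination of projections of intervals with end points in
     [D]; the empty sum takes its index from the inhabitedness of the directed set. *)
  elim: n {fa} => [|n IHn].
    have [[i0] _] := le_directed; move=> e e0; exists i0 => i _ h _ _.
    have -> : (fun x => step_op (Wn i) f a 0 h x - step_op W0 f a 0 h x) = fun=> 0.
      by apply/funext => x; rewrite !step_op0 subr0.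
    by rewrite (nm0 hS : nrm (fun=> 0) = 0).
  have /opnorm_limP PDn := PD _ _ (Da n) (Da n.+1).
  rewrite step_opS; under [X in unit_ball_lim _ X]eq_fun do rewrite step_opS.
  exact: (unit_ball_lim_lin le_directed (f (a n)) (fun i => Lstep _ (hWn i) n)
    (fun i => L2_PW (hWn i) _) (Lstep _ hW0 n) (L2_PW hW0 _) IHn PDn).
move=> /(_ _ e3)[i0 hi0]; exists i0 => i /hi0 hi h Lh h1.
have -> : eps = eps / 3 + eps / 3 + eps / 3 by field.
apply: (@nrm_chain _ _ (step_op (Wn i) f a n h) (step_op W0 f a n h)).
- exact: L2_intPW.
- exact: Lstep.
- exact: Lstep.
- exact: L2_intPW.
- by apply: intPW_step_op_le => //; exact: ltW.
- exact: hi.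
- by apply: intPW_step_op_le => //; exact: ltW.
Qed.

Definition eigenvalue_free (a e : R) (W : R -> R -> R) :=
  forall l, eigenvalue_of W l -> e <= `|l - a|.

Lemma eigenvalue_free_dense :
  dense [set a | exists2 e, 0 < e & eigenvalue_free a e W0].
Proof.
move=> O [x Ox] oO.
have /nbhs_ballP[r /= r0 hr] : nbhs x O by exact: open_nbhs_nbhs.
have xr : x < x + r by rewrite ltrDl.
have [a [e [e0 /andP[xa ax] h]]] := eigenvalue_gap hW0 xr.
exists a; split; last by exists e.
by apply: hr; rewrite /ball/= distrC gtr0_norm ?subr_gt0//; lra.
Qed.

Hypothesis intPW_lim : forall f : R -> R, Cc f ->
  opnorm_lim le (fun i => intPW (Wn i) f) (intPW W0 f).

(* The tent at a vanishes on the spectrum of W0, so its integral against the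
   limit is 0, whereas an eigenvalue of W_i within e/2 of a would make the
   norm of its integral at least 1/2. *)
Lemma eigenvalue_free_eventually (a e : R) : 0 < e -> eigenvalue_free a e W0 ->
  exists i0, forall i, le i0 i -> eigenvalue_free a (e / 2) (Wn i).
Proof.
move=> e0 he; pose f := trapezoid (a - e) (a + e) e.
have Cf : Cc f by exact: trapezoid_Cc.
have /opnorm_limP/(_ 2^-1)[|i0 hi0] := intPW_lim Cf; first by rewrite invr_gt0.
exists i0 => i /hi0 hi l /(unit_eigenvector (hWn i))[v [Ev v1]].
rewrite leNgt; apply/negP => /ltW /(tent_ge_half e0); rewrite -/f => fl.
have Lv : L2 v by case: Ev.
have := hi v Lv; rewrite v1 lexx => /(_ isT); rewrite ltNge => /negP; apply.
have LA := L2_intPW (hWn i) Cf Lv; have LB := L2_intPW hW0 Cf Lv.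
have B0 : nrm (intPW W0 f v) = 0.
  by apply: nrm_intPW_eq0 => // m Em; apply: tent_eq0 => //; exact: he.
have := nm_tri0 hS LA LB; rewrite [X in _ + X]B0 addr0; apply: le_trans.
rewrite [leRHS](intPW_eigvec (hWn i) Cf Ev v1); apply: le_trans fl _.
exact: ler_norm.
Qed.

Lemma intPW_lim_vague : vague_conv le Wn W0.
Proof.
exists [set a | exists2 e, 0 < e & eigenvalue_free a e W0].
split; first exact: eigenvalue_free_dense.
move=> a b [ea ea0 ha] [eb eb0 hb].
(* The free radii of [W0] are only halved for [Wn i], so one trapezoid of ramp width [d] is exact
   for both. *)
pose d := Num.min ea eb / 2.
have [m0 mea meb] : [/\ 0 < Num.min ea eb, Num.min ea eb <= ea
    & Num.min ea eb <= eb] by rewrite lt_min ea0 eb0 !ge_min !lexx orbT.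
have d0 : 0 < d by rewrite divr_gt0.
pose f := trapezoid a b d.
have Cf : Cc f by exact: trapezoid_Cc.
have fE W : eigenvalue_free a d W -> eigenvalue_free b d W ->
    forall l, eigenvalue_of W l -> f l = (a < l <= b)%R%:R.
  by move=> Wa Wb l El; apply: trapezoid_indicator => //; [exact: Wa|exact: Wb].
have weaken c e W : d <= e -> eigenvalue_free c e W -> eigenvalue_free c d W.
  by move=> de h l /h; exact: le_trans.
have [i1 hi1] := eigenvalue_free_eventually ea0 ha.
have [i2 hi2] := eigenvalue_free_eventually eb0 hb.
have [k hk] := directed_upper2 le_directed i1 i2.
apply/opnorm_limP => eps eps0.
have /opnorm_limP/(_ _ eps0)[i3 hi3] := intPW_lim Cf.
have [j hj] := directed_upper2 le_directed k i3.
exists j => i /hj[/hk[/hi1 ia /hi2 ib] /hi3 hi] h Lh h1.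
(* Both outer comparisons are exact; the whole error comes from the hypothesis. *)
have -> : eps = 0 + eps + 0 by rewrite add0r addr0.
apply: (@nrm_chain _ _ (intPW (Wn i) f h) (intPW W0 f h)).
- exact: L2_PW.
- exact: L2_intPW.
- exact: L2_intPW.
- exact: L2_PW.
- apply: PW_intPW_le0 => //; apply: fE.
    by apply: weaken ia; rewrite /d; lra.
  by apply: weaken ib; rewrite /d; lra.
- exact: hi.
- apply: PW_intPW_le0 => //; apply: fE.
    by apply: weaken ha; rewrite /d; lra.
  by apply: weaken hb; rewrite /d; lra.
Qed.

End VagueConvergence.

Theorem theorem2p2 (R : realType) (I : Type) (le : I -> I -> Prop)
    (Wn : I -> R -> R -> R) (W0 : R -> R -> R) :
  directed_set le ->
  (forall i, graphon (Wn i)) -> graphon W0 ->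
  (vague_conv le Wn W0 <->
   (forall f : R -> R, Cc f ->
      opnorm_lim le (fun i => intPW (Wn i) f) (intPW W0 f))).
Proof.
move=> le_directed hWn hW0; split=> [vague f|lim].
  exact: vague_intPW_lim.
exact: intPW_lim_vague.
Qed.
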